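(* Let $L$ be a relational language with finitely many relation symbols of every arity greater than one and with finitely or countably many unary relation symbols. Let $\mathbf H$ be a countable $L$-hypergraph universal for all countable $L$-hypergraphs. Then $\mathbf H$ has finite big Ramsey degrees.
   Context: Convention: every structure is countable, has vertex set some $n\in\omega$ or $\omega$ (ordered by the natural order $\le$), and all embeddings are embeddings of $L$-structures that are monotone with respect to $\le$; $\binom{\mathbf B}{\mathbf A}$ is the set of such embeddings $\mathbf A\to\mathbf B$. An $L$-hypergraph is an $L$-structure in which every relation is injective (no tuple has a repeated vertex) and symmetric (closed under permutations of tuples), and every tuple lies in at most one relation (in particular each vertex lies in at most one unary relation). For a countably infinite $\mathbf B$ and finite substructure $\mathbf A$, the big Ramsey degree of $\mathbf A$ in $\mathbf B$ is the least $\ell\in\omega+1$ such that for every $k\in\omega$ and every colouring $\chi:\binom{\mathbf B}{\mathbf A}\to k$ there is an embedding $f:\mathbf B\to\mathbf B$ such that $\chi$ takes at most $\ell$ values on embeddings $\mathbf A\to\mathbf B$ with image inside $f[B]$; $\mathbf B$ has finite big Ramsey degrees if this is finite for every finite substructure $\mathbf A$. *)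

(* Defs.v *)
From Stdlib Require Import List Arith Permutation.
Import ListNotations.

(* A relational language: for each arity a >= 2, finitely many symbols
   (nsym a of them, indexed 0..nsym a - 1); unary symbols indexed by k with
   k < n if nunary = Some n (finitely many), or all k : nat if nunary = None
   (countably many). *)
Record language := Language { nsym : nat -> nat; nunary : option nat }.

Definition inV (s : option nat) (x : nat) : Prop :=
  match s with Some n => x < n | None => True end.

Definition valid_sym (L : language) (a k : nat) : Prop :=
  (a = 1 /\ inV (nunary L) k) \/ (2 <= a /\ k < nsym L a).

Record structure (L : language) := Structure {
  vset : option nat;
  rel : nat -> nat -> list nat -> Prop;
  rel_wf : forall a k t, rel a k t ->
     valid_sym L a k /\ length t = a /\ Forall (inV vset) t }.
Arguments vset {L}.
Arguments rel {L}.

Definition is_finite {L} (A : structure L) : Prop :=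
  exists n, vset A = Some n.

(* Monotone (with respect to <=) embeddings of L-structures. Monotone and
   injective is the same as strictly increasing. *)
Definition embedding {L} (A B : structure L) (f : nat -> nat) : Prop :=
  (forall x, inV (vset A) x -> inV (vset B) (f x)) /\
  (forall x y, inV (vset A) x -> inV (vset A) y -> x < y -> f x < f y) /\
  (forall a k t, valid_sym L a k -> length t = a -> Forall (inV (vset A)) t ->
     (rel A a k t <-> rel B a k (map f t))).

Definition hypergraph {L} (H : structure L) : Prop :=
  (forall a k t, rel H a k t -> NoDup t) /\
  (forall a k t t', rel H a k t -> Permutation t t' -> rel H a k t') /\
  (forall a k a' k' t, rel H a k t -> rel H a' k' t -> a = a' /\ k = k').

Definition universal_hypergraph {L} (H : structure L) : Prop :=
  hypergraph H /\
  forall G : structure L, hypergraph G -> exists f, embedding G H f.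

(* An embedding e of a finite A with vertex set m is recorded by the list
   [e 0; ...; e (m-1)], which determines it. *)
Definition code (m : nat) (e : nat -> nat) : list nat := map e (seq 0 m).

Definition big_ramsey_le {L} (B A : structure L) (m l : nat) : Prop :=
  forall (k : nat) (chi : list nat -> nat),
    (forall s, chi s < k) ->
    exists f, embedding B B f /\
      exists cs : list nat, length cs <= l /\
        forall e, embedding A B e ->
          (forall x, x < m -> exists y, inV (vset B) y /\ e x = f y) ->
          In (chi (code m e)) cs.

Definition finite_big_ramsey_degrees {L} (B : structure L) : Prop :=
  forall (A : structure L) (m : nat), vset A = Some m ->
    (exists g, embedding A B g) ->
    exists l : nat, big_ramsey_le B A m l.

(* Main.v *)
From Stdlib Require Import List Arith Lia Permutation Cantor.
From Stdlib Require Import Classical ClassicalEpsilon FunctionalExtensionality.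
Require Import Defs.
Import ListNotations.

(* Label the subsets [S] of [{0, ..., n - 1}] by elements of finite sets depending on [|S|]; these
   are the nodes of level [n] of a finitely branching tree. Enumerating the vertices of a hypergraph,
   a vertex is such a node: the label of [S] is its relation with the set [S] of earlier vertices.
   Conversely, take as vertices all nodes, the relation of nodes of levels p_0 < ... < p_s being the
   label of {p_0, ..., p_(s-1)} in the last one; this is a universal hypergraph. It is self-similar:
   the monoid of level- and label-preserving tree maps acts on it by embeddings.

   The Halpern-Läuchli theorem gives a pigeonhole principle for this monoid, and a fusion argument
   turns it into a Milliken-type theorem: if the colour of a map depends only on finitely many
   levels (and labels), then it is constant on a right ideal [W o M]. No infinite product of trees
   is needed, since copies of a structure with [m] vertices are determined by finitely many types.

   To deduce finite big Ramsey degrees, the given hypergraph is embedded among the nodes so sparsely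
   that before each vertex level the nodes have already announced, in extra bits at non-vertex
   levels, their relations at that level. Hence nodes only branch apart at announcement levels, and
   [m] of them lie in the image of boundedly many levels under one map of the monoid; their colour
   is then determined by one of finitely many preimages. High arities do no harm: relations that
   were announced beforehand cause no further branching. *)

(** * The Halpern-Läuchli theorem *)

Lemma fun_choice (A B : Type) (R : A -> B -> Prop) :
  (forall x, exists y, R x y) -> exists f, forall x, R x (f x).
Proof.
  intros H. exists (fun x => proj1_sig (constructive_indefinite_description _ (H x))).
  intros x. exact (proj2_sig (constructive_indefinite_description _ (H x))).
Qed.

Lemma pigeonhole_infinite (c : nat -> nat) (K : nat) :
  (forall k, c k < K) -> exists v, forall m, exists k, m <= k /\ c k = v.
Proof.
  intros Hc. apply NNPP. intros Hn.
  assert (H : forall v, exists m, forall k, m <= k -> c k <> v).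
  { intros v. apply NNPP. intros H. apply Hn. exists v. intros m. apply NNPP.
    intros H'. apply H. exists m. intros k Hk E. apply H'. eauto. }
  assert (H' : forall N, exists m, forall v, v < N -> forall k, m <= k -> c k <> v).
  { induction N as [|N [m Hm]]. { exists 0. lia. }
    destruct (H N) as [m' Hm']. exists (m + m'). intros v Hv k Hk.
    destruct (Nat.eq_dec v N) as [->|]; [apply Hm'|apply Hm]; lia. }
  destruct (H' K) as [m Hm]. exact (Hm (c m) (Hc m) m (le_n m) eq_refl).
Qed.

Lemma finite_Forall2 (A B : Type) (R : A -> B -> Prop) :
  (forall a, exists l, forall b, R a b -> In b l) ->
  forall xs, exists l, forall ys, Forall2 R xs ys -> In ys l.
Proof.
  intros H. induction xs as [|x xs [l Hl]].
  { exists [[]]. intros ys Hy. inversion Hy. now left. }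
  destruct (H x) as [lx Hx].
  exists (map (fun p => fst p :: snd p) (list_prod lx l)). intros ys Hy.
  inversion Hy as [|? y ? ys' Hxy Hys]; subst.
  apply in_map_iff. exists (y, ys'). split; [reflexivity|]. apply in_prod; auto.
Qed.

Lemma Forall2_map_same (A B C : Type) (R : A -> B -> Prop) (S : A -> C -> Prop) (f : B -> C) xs ys :
  (forall x y, R x y -> S x (f y)) -> Forall2 R xs ys -> Forall2 S xs (map f ys).
Proof. intros H. induction 1; simpl; constructor; auto. Qed.

Section HalpernLauchli.

Variables (X : Type) (T : nat -> X -> Prop) (res : nat -> X -> X).
Hypothesis T_res : forall m n x, T m x -> n <= m -> T n (res n x).
Hypothesis res_same : forall m x, T m x -> res m x = x.
Hypothesis res_res : forall m n n' x, T m x -> n <= n' -> n' <= m -> res n (res n' x) = res n x.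
Hypothesis T_succ : forall n x, T n x -> exists y, T (S n) y /\ res n y = x.
Hypothesis T_fin : forall n m x, exists l, forall y, T m y -> res n y = x -> In y l.

Lemma T_ext_ex n m x : T n x -> n <= m -> exists y, T m y /\ res n y = x.
Proof.
  intros Hx. induction 1 as [|m Hm [y [Hy Ey]]]; [eauto|].
  destruct (T_succ _ _ Hy) as [z [Hz Ez]]. exists z. split; [exact Hz|].
  rewrite <- Ey, <- Ez. symmetry. apply (res_res (S m)); auto; lia.
Qed.

Definition above (n m : nat) (ts ys : list X) : Prop :=
  Forall2 (fun t y => T m y /\ res n y = t) ts ys.

Lemma above_trans n n' m ts ss ys :
  n <= n' -> n' <= m -> above n n' ts ss -> above n' m ss ys -> above n m ts ys.
Proof.
  intros Hn Hm H. revert ys. induction H as [|t s ts ss [Hs Es] H IH]; intros ys Hy;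
    inversion Hy as [|? y ? ys' [Ty Ey] Hys]; subst; constructor.
  - split; [exact Ty|]. symmetry. apply (res_res m); auto.
  - apply IH. exact Hys.
Qed.

Lemma above_refl n ts : Forall (T n) ts -> above n n ts ts.
Proof. induction 1; constructor; auto. Qed.

Lemma above_fin n m ts : exists l, forall ys, above n m ts ys -> In ys l.
Proof.
  apply finite_Forall2. intros x. destruct (T_fin n m x) as [l Hl]. exists l.
  intros y [Hy Ey]. auto.
Qed.

(* A selector [(k, d)] sends every node of level [m] to one of its extensions at
   level [k m]; no coherence between different levels is required. *)
Definition sel : Type := ((nat -> nat) * (nat -> X -> X))%type.

Definition is_sel (D : sel) : Prop :=
  forall m, m <= fst D m /\ forall x, T m x -> T (fst D m) (snd D m x) /\ res m (snd D m x) = x.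

Definition comp (D E : sel) : sel :=
  (fun m => fst D (fst E m), fun m x => snd D (fst E m) (snd E m x)).

Definition sel_id : sel := (fun m => m, fun _ x => x).

Lemma is_sel_id : is_sel sel_id.
Proof. intros m. split; simpl; auto. Qed.

Lemma is_sel_comp D E : is_sel D -> is_sel E -> is_sel (comp D E).
Proof.
  intros HD HE m. destruct (HE m) as [H1 H2]. destruct (HD (fst E m)) as [H3 H4].
  split; simpl; [lia|]. intros x Hx. destruct (H2 x Hx) as [H5 H6].
  destruct (H4 _ H5) as [H7 H8]. split; [exact H7|].
  rewrite <- (res_res (fst D (fst E m)) m (fst E m)) by auto. now rewrite H8.
Qed.

Lemma above_sel D n m ts ys : is_sel D -> n <= m ->
  above n m ts ys -> above n (fst D m) ts (map (snd D m) ys).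
Proof.
  intros HD Hn. apply Forall2_map_same. intros t y [Hy Ey].
  destruct (HD m) as [Hm H]. destruct (H y Hy) as [H1 H2]. split; [exact H1|].
  rewrite <- (res_res (fst D m) n m) by auto. now rewrite H2.
Qed.

(** Composed on the inside, it pushes all values past a given level, where the diagonal branch
    already extends a prescribed node. *)
Lemma shift_sel P : exists D, is_sel D /\ forall m, P <= fst D m.
Proof.
  assert (H : forall a : nat * X, exists y, T (fst a) (snd a) ->
            T (Nat.max (fst a) P) y /\ res (fst a) y = snd a).
  { intros [m x]. destruct (classic (T m x)) as [Hx|Hx].
    - destruct (T_ext_ex m (Nat.max m P) x Hx) as [y Hy]; [lia|]. exists y. auto.
    - exists x. intros Hx'. contradiction. }
  destruct (fun_choice _ _ _ H) as [f Hf].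
  exists (fun m => Nat.max m P, fun m x => f (m, x)). split; [|simpl; intros; lia].
  intros m. split; simpl; [lia|]. intros x Hx. exact (Hf (m, x) Hx).
Qed.

(** * Adding one tree in the Halpern-Läuchli induction *)

Section Step.

Variables (c : nat -> list X -> nat) (K n : nat) (z0 : X) (ts : list X).
Hypothesis c_lt : forall k xs, c k xs < K.
Hypothesis Tz0 : T n z0.
Hypothesis Tts : Forall (T n) ts.
Hypothesis z0_notin : ~ In z0 ts.

Hypothesis IH : forall (c' : nat -> list X -> nat), (forall k xs, c' k xs < K) ->
  exists D n1 ss v, is_sel D /\ n <= n1 /\ above n n1 ts ss /\
    forall m ys, n1 <= m -> above n1 m ss ys -> c' (fst D m) (map (snd D m) ys) = v.

Definition over (D : sel) (n1 p : nat) (z : X) (w : nat -> X) : Prop :=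
  forall m, n1 <= m -> p <= fst D m /\ T (fst D m) (w m) /\ res p (w m) = z.

(* Below [D], no choice of nodes above [z] forces the colour [v] on the whole cone above [s]. *)
Definition dead (D : sel) (n1 : nat) (s : list X) (p : nat) (z : X) (v : nat) : Prop :=
  forall E w, is_sel E -> over (comp D E) n1 p z w ->
    exists m ys, n1 <= m /\ above n1 m s ys /\
      c (fst (comp D E) m) (w m :: map (snd (comp D E) m) ys) <> v.

Lemma dead_comp D E n1 s p z v : is_sel E -> dead D n1 s p z v -> dead (comp D E) n1 s p z v.
Proof.
  intros HE H E' w HE' Hw. apply (H (comp E E') w); [now apply is_sel_comp|exact Hw].
Qed.

Lemma dead_up D n1 s p z v p' z' : T p' z' -> p <= p' -> res p z' = z ->
  dead D n1 s p z v -> dead D n1 s p' z' v.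
Proof.
  intros Hz' Hp Ez H E w HE Hw. apply H; [exact HE|]. intros m Hm.
  destruct (Hw m Hm) as [H1 [H2 H3]]. split; [lia|]. split; [exact H2|].
  rewrite <- Ez, <- H3. symmetry. apply (res_res (fst (comp D E) m)); auto.
Qed.

(** Selectors never lower levels, so deadness at [n1] sees [D] only from level [n1] on. This permits
    passing to a diagonal selector. *)
Lemma dead_agree D D' n1 s p z v :
  (forall m, n1 <= m -> fst D m = fst D' m /\ forall x, snd D m x = snd D' m x) ->
  dead D n1 s p z v -> dead D' n1 s p z v.
Proof.
  intros HD H E w HE Hw.
  assert (Hm' : forall m, n1 <= m -> n1 <= fst E m) by (intros m Hm; destruct (HE m); lia).
  destruct (H E w HE) as [m [ys [Hm [Hys Hc]]]].
  { intros m Hm. specialize (Hw m Hm). simpl in *.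
    destruct (HD (fst E m) (Hm' m Hm)) as [-> _]. exact Hw. }
  exists m, ys. split; [exact Hm|]. split; [exact Hys|]. simpl in *.
  destruct (HD (fst E m) (Hm' m Hm)) as [E1 E2]. rewrite <- E1.
  erewrite map_ext; [exact Hc|]. intros x. simpl. now rewrite E2.
Qed.


(** The opposite alternative, made hereditary: neither lengthening [z] nor refining [D] leads to
    death, so above every extension of [z] a forcing choice exists after a refinement. *)
Definition uniform (D : sel) (n1 : nat) (s : list X) (p : nat) (z : X) (v : nat) : Prop :=
  forall p' z' E, p <= p' -> T p' z' -> res p z' = z -> is_sel E -> ~ dead (comp D E) n1 s p' z' v.

Section NoUniform.

Hypothesis Hno : forall D N s v p z, is_sel D -> n <= N -> above n N ts s -> n <= p -> T p z ->
  res n z = z0 -> ~ uniform D N s p z v.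

(** Without uniformity each single pair can be killed by lengthening [z] and refining [D]. Earlier
    kills survive by [dead_comp] and [dead_up], so a finite list is handled pair by pair. *)
Lemma kill_all (N : nat) (L : list (list X * nat)) D p z :
  n <= N -> (forall a, In a L -> above n N ts (fst a)) ->
  is_sel D -> n <= p -> T p z -> res n z = z0 ->
  exists E p' z', is_sel E /\ p <= p' /\ T p' z' /\ res p z' = z /\
    forall a, In a L -> dead (comp D E) N (fst a) p' z' (snd a).
Proof.
  intros HN. induction L as [|[s v] L IHL]; intros HL HD Hp Hz Ez.
  { exists sel_id, p, z. repeat split; auto using is_sel_id. intros a []. }
  assert (Hs : above n N ts s) by exact (HL (s, v) (or_introl eq_refl)).
  destruct (IHL (fun a Ha => HL a (or_intror Ha)) HD Hp Hz Ez)
    as [E [p1 [z1 [HE [Hp1 [Hz1 [Ez1 Hd]]]]]]].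
  assert (Ez1' : res n z1 = z0).
  { rewrite <- Ez, <- Ez1. symmetry. apply (res_res p1); auto. }
  destruct (classic (exists p2 z2 E2, p1 <= p2 /\ T p2 z2 /\ res p1 z2 = z1 /\
            is_sel E2 /\ dead (comp (comp D E) E2) N s p2 z2 v)) as [Hk|Hk].
  - destruct Hk as [p2 [z2 [E2 [Hp2 [Hz2 [Ez2 [HE2 Hd2]]]]]]].
    exists (comp E E2), p2, z2. split; [now apply is_sel_comp|]. split; [lia|].
    split; [exact Hz2|]. split.
    { rewrite <- Ez1, <- Ez2. symmetry. apply (res_res p2); auto. }
    intros a [<-|Ha]; [exact Hd2|].
    apply (dead_up _ _ _ p1 z1); auto.
    apply (dead_comp (comp D E) E2); auto.
  - exfalso. apply (Hno (comp D E) N s v p1 z1); auto; [now apply is_sel_comp|lia|].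
    intros p2 z2 E2 Hp2 Hz2 Ez2 HE2 Hd2. apply Hk. exists p2, z2, E2. auto 10.
Qed.

Definition state : Type := (sel * (nat * X))%type.

Definition valid (st : state) : Prop :=
  let '(D, (p, z)) := st in is_sel D /\ n <= p /\ T p z /\ res n z = z0.

Definition refines (st st' : state) : Prop :=
  let '(D, (p, z)) := st in let '(D', (p', z')) := st' in
  (exists E, is_sel E /\ D' = comp D E) /\ p <= p' /\ res p z' = z.

Lemma refines_trans a b d : valid b -> valid d -> refines a b -> refines b d -> refines a d.
Proof.
  destruct a as [D1 [p1 z1]], b as [D2 [p2 z2]], d as [D3 [p3 z3]]. simpl.
  intros V2 V3 [[E [HE ->]] [Hp Hz]] [[E' [HE' ->]] [Hp' Hz']]. split.
  { exists (comp E E'). split; [now apply is_sel_comp|reflexivity]. }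
  split; [lia|]. rewrite <- Hz, <- Hz'. symmetry. apply (res_res p3); tauto.
Qed.

Lemma stage (N : nat) (st : state) : exists st', valid st ->
  valid st' /\ refines st st' /\ fst (snd st) < fst (snd st') /\
  forall s v, n <= N -> above n N ts s -> v < K ->
    dead (fst st') N s (fst (snd st')) (snd (snd st')) v.
Proof.
  destruct (classic (valid st)) as [Hv|Hv]; [|exists st; contradiction].
  destruct st as [D [p z]]. destruct Hv as [HD [Hp [Hz Ez]]].
  (* One level is gained first, so that the nodes of the successive stages determine an infinite
     branch. *)
  destruct (T_succ _ _ Hz) as [z1 [Hz1 Ez1]].
  destruct (above_fin n N ts) as [l Hl].
  set (L := if le_dec n N then
     filter (fun a => if excluded_middle_informative (above n N ts (fst a)) then true else false)
            (list_prod l (seq 0 K)) else []).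
  assert (HL : forall a, In a L -> n <= N /\ above n N ts (fst a)).
  { intros a. unfold L. destruct (le_dec n N) as [HN|]; [|intros []].
    intros [_ Ha]%filter_In. destruct (excluded_middle_informative _); [auto|discriminate]. }
  assert (Hk : exists E p' z', is_sel E /\ S p <= p' /\ T p' z' /\ res (S p) z' = z1 /\
    forall a, In a L -> dead (comp D E) N (fst a) p' z' (snd a)).
  { destruct (le_dec n N) as [HN|HN].
    - apply kill_all; auto; [intros a Ha; apply HL; exact Ha|].
      rewrite <- Ez, <- Ez1. symmetry. apply (res_res (S p)); auto.
    - exists sel_id, (S p), z1. split; [apply is_sel_id|]. split; [lia|].
      split; [exact Hz1|]. split; [auto|]. intros a Ha. destruct (HL a Ha). contradiction. }
  destruct Hk as [E [p' [z' [HE [Hp' [Hz' [Ez' Hd]]]]]]].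
  assert (Ezz : res p z' = z).
  { rewrite <- Ez1, <- Ez'. symmetry. apply (res_res p'); auto. }
  assert (HDE : is_sel (comp D E)) by now apply is_sel_comp.
  exists (comp D E, (p', z')). intros _. split; [|split; [|split]].
  - split; [exact HDE|]. split; [lia|]. split; [exact Hz'|].
    rewrite <- Ez, <- Ezz. symmetry. apply (res_res p'); auto; lia.
  - split; [exists E; auto|]. split; [lia|exact Ezz].
  - simpl. lia.
  - intros s v HN Hs Hv. apply (Hd (s, v)). unfold L.
    destruct (le_dec n N) as [_|]; [|contradiction].
    apply filter_In. split.
    + apply in_prod; [now apply Hl|]. apply in_seq. lia.
    + simpl. destruct (excluded_middle_informative _); [reflexivity|contradiction].
Qed.

(* Follow a branch of the last tree along which every pair [(s, v)] is killed, diagonalizing the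
   selectors; the induction hypothesis for the colouring along that branch revives one pair. *)
Lemma no_uniform_absurd : False.
Proof.
  assert (H : forall a : nat * state, exists st', valid (snd a) ->
    valid st' /\ refines (snd a) st' /\ fst (snd (snd a)) < fst (snd st') /\
    forall s v, n <= fst a -> above n (fst a) ts s -> v < K ->
      dead (fst st') (fst a) s (fst (snd st')) (snd (snd st')) v).
  { intros [N st]. apply stage. }
  destruct (fun_choice _ _ _ H) as [next Hnext]. clear H.
  set (st := fix st (i : nat) : state :=
         match i with 0 => (sel_id, (n, z0)) | S i => next (i, st i) end).
  assert (Hst0 : valid (st 0)).
  { simpl. repeat split; auto. }
  assert (Hval : forall i, valid (st i)).
  { induction i as [|i IHi]; [exact Hst0|]. exact (proj1 (Hnext (i, st i) IHi)). }
  assert (Hstep : forall i, refines (st i) (st (S i)) /\ fst (snd (st i)) < fst (snd (st (S i))) /\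
    forall s v, n <= i -> above n i ts s -> v < K ->
      dead (fst (st (S i))) i s (fst (snd (st (S i)))) (snd (snd (st (S i)))) v).
  { intros i. exact (proj2 (Hnext (i, st i) (Hval i))). }
  assert (Href : forall i j, i <= j -> refines (st i) (st j)).
  { intros i j. induction 1 as [|j Hj IHj].
    - destruct (st i) as [D [p z]] eqn:E. specialize (Hval i). rewrite E in Hval.
      destruct Hval as [HD [Hp [Hz Ez]]]. simpl. repeat split; auto.
      exists sel_id. split; [apply is_sel_id|]. destruct D. reflexivity.
    - apply (refines_trans _ (st j)); auto. apply Hstep. }
  assert (Hlev : forall i, i <= fst (snd (st i))).
  { induction i as [|i IHi]; [lia|]. destruct (Hstep i) as [_ [Hi _]]. lia. }
  clearbody st. clear next Hnext Hst0.
  (* The diagonal uses at level [m] the selector of stage [m + 1]; [b] is the branch through the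
     nodes of all stages. *)
  set (Dinf := ((fun m => fst (fst (st (S m))) m, fun m x => snd (fst (st (S m))) m x) : sel)).
  set (b := fun k => res k (snd (snd (st k)))).
  assert (HDinf : is_sel Dinf).
  { intros m. pose proof (Hval (S m)) as Hv. destruct (st (S m)) as [D [p z]] eqn:E.
    destruct Hv as [HD _]. unfold Dinf. simpl. rewrite E. simpl. apply HD. }
  (* All later stages refine stage [N + 1], so from level [N] on the diagonal does too. The factor
     [R] is chosen level by level, which is allowed since selectors need no coherence. *)
  assert (Hagree : forall N, exists R, is_sel R /\ forall m, N <= m ->
            fst Dinf m = fst (comp (fst (st (S N))) R) m /\
            forall x, snd Dinf m x = snd (comp (fst (st (S N))) R) m x).
  { intros N.
    assert (HE : forall m, exists E, is_sel E /\
              (N <= m -> fst (st (S m)) = comp (fst (st (S N))) E)).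
    { intros m. destruct (le_dec N m) as [Hm|Hm].
      - pose proof (Href (S N) (S m) ltac:(lia)) as Hr.
        destruct (st (S N)) as [D1 [p1 z1]], (st (S m)) as [D2 [p2 z2]].
        destruct Hr as [[E [HE ->]] _]. exists E. auto.
      - exists sel_id. split; [apply is_sel_id|lia]. }
    destruct (fun_choice _ _ _ HE) as [E HE'].
    exists (fun m => fst (E m) m, fun m x => snd (E m) m x). split.
    - intros m. destruct (HE' m) as [H _]. apply H.
    - intros m Hm. destruct (HE' m) as [_ Hq]. unfold Dinf. simpl.
      rewrite (Hq Hm). simpl. auto. }
  assert (Hb : forall N k, fst (snd (st N)) <= k ->
            T k (b k) /\ res (fst (snd (st N))) (b k) = snd (snd (st N))).
  { intros N k Hk. unfold b. pose proof (Hlev k) as Hlk. pose proof (Hval k) as Hvk.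
    pose proof (Hlev N) as HlN. pose proof (Href N k ltac:(lia)) as Hr.
    destruct (st k) as [D2 [p2 z2]], (st N) as [D1 [p1 z1]]. simpl in *.
    destruct Hvk as [_ [_ [Hz2 _]]]. destruct Hr as [_ [_ Hr]].
    split; [apply (T_res p2); auto|]. rewrite (res_res p2); auto. }
  destruct (IH (fun k xs => c (fst Dinf k) (b (fst Dinf k) :: map (snd Dinf k) xs)))
    as [D [n1 [ss [v [HD [Hn1 [Hss Hv]]]]]]]; [auto|].
  (* The colour [v] is attained on [ss] itself, hence it is among the colours killed at stage
     [n1 + 1]. *)
  assert (HvK : v < K).
  { rewrite <- (Hv n1 ss (le_n n1)); [auto|].
    apply above_refl. clear -Hss. induction Hss; constructor; tauto. }
  destruct (Hstep n1) as [_ [_ Hdead]].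
  specialize (Hdead ss v Hn1 Hss HvK).
  destruct (Hagree n1) as [R [HR HDR]].
  (* After this shift the branch values in use extend the node of stage [n1 + 1], as [over]
     demands. *)
  destruct (shift_sel (fst (snd (st (S n1))))) as [Sh [HSh HShl]].
  pose proof (dead_comp _ _ _ _ _ _ _ HR Hdead) as Hd1.
  apply (dead_agree _ Dinf) in Hd1.
  2:{ intros m Hm. destruct (HDR m Hm) as [E1 E2]. split; [auto|]. intros x. symmetry. apply E2. }
  destruct (Hd1 (comp D Sh) (fun m => b (fst (comp Dinf (comp D Sh)) m)))
    as [m [ys [Hm [Hys Hne]]]].
  - now apply is_sel_comp.
  - intros m Hm.
    assert (Hle : fst (snd (st (S n1))) <= fst (comp Dinf (comp D Sh)) m).
    { pose proof (proj1 (HDinf (fst D (fst Sh m)))). pose proof (proj1 (HD (fst Sh m))).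
      specialize (HShl m). simpl in *. lia. }
    split; [exact Hle|]. now apply Hb.
  - apply Hne. specialize (Hv (fst Sh m) (map (snd Sh m) ys)). simpl in *.
    rewrite !map_map in *. apply Hv.
    + pose proof (proj1 (HSh m)). lia.
    + now apply above_sel.
Qed.

End NoUniform.

Lemma uniform_ex : exists D N s v p z, is_sel D /\ n <= N /\ above n N ts s /\ n <= p /\ T p z /\
  res n z = z0 /\ uniform D N s p z v.
Proof.
  apply NNPP. intros H. apply no_uniform_absurd.
  intros D N s v p z HD HN Hs Hp Hz Ez Hu. apply H. exists D, N, s, v, p, z. auto 10.
Qed.


(** Uniformity provides a forcing choice above one node after one more refinement. Choices made
    earlier are reindexed along that refinement and still force, because a selector maps a cone into
    itself. *)
Lemma force_all D N s v p z q : is_sel D -> uniform D N s p z v -> p <= q ->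
  forall zs, (forall z', In z' zs -> T q z' /\ res p z' = z) ->
  exists E, is_sel E /\ forall z', In z' zs ->
    exists w, over (comp D E) N q z' w /\ forall m ys, N <= m -> above N m s ys ->
      c (fst (comp D E) m) (w m :: map (snd (comp D E) m) ys) = v.
Proof.
  intros HD Hu Hpq. induction zs as [|z' zs IHzs]; intros Hzs.
  { exists sel_id. split; [apply is_sel_id|]. intros z' []. }
  destruct IHzs as [E [HE Hw]]; [intros; apply Hzs; now right|].
  destruct (Hzs z') as [Tz' Ez']; [now left|].
  assert (Hn : exists E' w, is_sel E' /\ over (comp (comp D E) E') N q z' w /\
     forall m ys, N <= m -> above N m s ys ->
       c (fst (comp (comp D E) E') m) (w m :: map (snd (comp (comp D E) E') m) ys) = v).
  { apply NNPP. intros Hn. apply (Hu q z' E Hpq Tz' Ez' HE). intros E' w HE' Hov.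
    apply NNPP. intros Hm. apply Hn. exists E', w. split; [exact HE'|]. split; [exact Hov|].
    intros m ys Hm' Hys. apply NNPP. intros Hc. apply Hm. exists m, ys. auto. }
  destruct Hn as [E' [w [HE' [Hov Hc]]]].
  exists (comp E E'). split; [now apply is_sel_comp|]. intros y [<-|Hy].
  { exists w. split; [exact Hov|exact Hc]. }
  destruct (Hw y Hy) as [w' [Hov' Hc']]. exists (fun m => w' (fst E' m)).
  split.
  - intros m Hm. apply (Hov' (fst E' m)). pose proof (proj1 (HE' m)). lia.
  - intros m ys Hm Hys. specialize (Hc' (fst E' m) (map (snd E' m) ys)). simpl in *.
    rewrite !map_map in *. apply Hc'.
    + pose proof (proj1 (HE' m)). lia.
    + now apply above_sel.
Qed.

Lemma add_root : exists D n1 ss v, is_sel D /\ n <= n1 /\ above n n1 (z0 :: ts) ss /\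
    forall m ys, n1 <= m -> above n1 m ss ys -> c (fst D m) (map (snd D m) ys) = v.
Proof.
  destruct uniform_ex as [D0 [N [s [v [p [z [HD0 [HN [Hs [Hp [Hz [Ez Hu]]]]]]]]]]]].
  (* A common level for the lengthened root [z] and the other roots [s]. *)
  set (M := Nat.max N p).
  destruct (T_ext_ex p M z Hz) as [z1 [Hz1 Ez1]]; [unfold M; lia|].
  assert (Hs1 : exists s1, above N M s s1).
  { clear -Hs T_res res_same res_res T_succ T_fin. induction Hs as [|t y ts ss [Hy _] Hs [s1 IHs]].
    - exists []. constructor.
    - destruct (T_ext_ex N M y Hy) as [y1 Hy1]; [unfold M; lia|].
      exists (y1 :: s1). now constructor. }
  destruct Hs1 as [s1 Hs1].
  assert (HzM : res n z1 = z0).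
  { rewrite <- Ez, <- Ez1. symmetry. apply (res_res M); auto; unfold M; lia. }
  assert (Hs1n : above n M ts s1) by (apply (above_trans n N M _ s); auto; unfold M; lia).
  assert (Hdis : ~ In z1 s1).
  { intros Hin. apply z0_notin. rewrite <- HzM. clear -Hin Hs1n.
    induction Hs1n as [|t y ts ss [_ Hy] _ IH]; [contradiction|].
    destruct Hin as [->|Hin]; [left; auto|right; auto]. }
  (* For each [m] separately all extensions of [z1] at level [m] are forced; the results for
     different [m] need not fit together. *)
  assert (Hm : forall m, exists kf : nat * (X -> X), m <= fst kf /\
            (forall x, T m x -> T (fst kf) (snd kf x) /\ res m (snd kf x) = x) /\
            (M <= m -> forall ys, above M m (z1 :: s1) ys -> c (fst kf) (map (snd kf) ys) = v)).
  { intros m. destruct (le_dec M m) as [HMm|];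
      [|exists (m, fun x => x); simpl; repeat split; auto; lia].
    destruct (T_fin M m z1) as [l Hl].
    set (zs := filter (fun y => if excluded_middle_informative (T m y /\ res M y = z1)
                                then true else false) l).
    assert (Hzs : forall y, In y zs <-> T m y /\ res M y = z1).
    { intros y. unfold zs. rewrite filter_In.
      destruct (excluded_middle_informative _) as [Hy|Hy].
      - split; [intros _; exact Hy|]. intros _. split; [apply Hl; tauto|reflexivity].
      - split; [intros [_ Hf]; discriminate|contradiction]. }
    destruct (force_all D0 N s v p z m HD0 Hu) with (zs := zs) as [E [HE Hw]];
      [unfold M in HMm; lia| |].
    { intros y [Hy Ey]%Hzs. split; [exact Hy|]. rewrite <- Ez1, <- Ey.
      symmetry. apply (res_res m); auto; unfold M; lia. }
    set (DE := comp D0 E) in *.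
    assert (HDE : is_sel DE) by now apply is_sel_comp.
    assert (Hw' : forall y, exists u, In y zs -> T (fst DE m) u /\ res m u = y /\
       forall ys, above N m s ys -> c (fst DE m) (u :: map (snd DE m) ys) = v).
    { intros y. destruct (classic (In y zs)) as [Hy|Hy]; [|exists y; contradiction].
      destruct (Hw y Hy) as [w [Hov Hc]]. exists (w m). intros _.
      destruct (Hov m) as [_ [H1 H2]]; [unfold M in HMm; lia|].
      split; [exact H1|]. split; [exact H2|]. intros ys Hys. apply Hc; [|exact Hys].
      unfold M in HMm; lia. }
    destruct (fun_choice _ _ _ Hw') as [u Hu'].
    (* Extensions of [z1] take their forcing choice, all other nodes follow [DE]. The cases do not
       clash because [z1] is not in [s1]. *)
    exists (fst DE m, fun y => if excluded_middle_informative (In y zs) then u y else snd DE m y).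
    simpl. split; [apply HDE|]. split.
    - intros x Hx. destruct (excluded_middle_informative (In x zs)) as [Hin|Hin].
      + destruct (Hu' x Hin) as [H1 [H2 _]]. auto.
      + apply HDE. exact Hx.
    - intros _ ys Hys. inversion Hys as [|? y ? ys' [Hy Ey] Hys']; subst. simpl.
      destruct (excluded_middle_informative (In y zs)) as [Hin|Hin].
      2:{ exfalso. apply Hin, Hzs. auto. }
      assert (Hrest : above N m s ys').
      { apply (above_trans N M m _ s1); auto; unfold M; lia. }
      destruct (Hu' y Hin) as [_ [_ Hc]]. rewrite <- (Hc ys' Hrest). f_equal. f_equal.
      apply map_ext_in. intros x Hx.
      destruct (excluded_middle_informative (In x zs)) as [Hin'|]; [|reflexivity].
      exfalso. apply Hdis. apply Hzs in Hin' as [_ Ex]. rewrite <- Ex.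
      clear -Hx Hys'. induction Hys' as [|t x' ts' ss' [_ Hx'] _ IH]; [contradiction|].
      destruct Hx as [->|Hx]; [left; auto|right; auto]. }
  destruct (fun_choice _ _ _ Hm) as [kf Hkf].
  exists (fun m => fst (kf m), fun m => snd (kf m)), M, (z1 :: s1), v.
  split.
  { intros m. destruct (Hkf m) as [H1 [H2 _]]. split; [exact H1|exact H2]. }
  split; [unfold M; lia|]. split.
  { constructor; [auto|exact Hs1n]. }
  intros m ys HMm Hys. simpl. now apply Hkf.
Qed.

End Step.

(** Induction on the number of roots. Without roots, some colour occurs at infinitely many levels
    and the selector jumps to those; [add_root] is the induction step. *)
Theorem halpern_lauchli (n : nat) (ts : list X) (K : nat) (c : nat -> list X -> nat) :
  Forall (T n) ts -> NoDup ts -> (forall k xs, c k xs < K) ->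
  exists D n1 ss v, is_sel D /\ n <= n1 /\ above n n1 ts ss /\
    forall m ys, n1 <= m -> above n1 m ss ys -> c (fst D m) (map (snd D m) ys) = v.
Proof.
  intros HT HN. revert c. induction ts as [|z ts IH]; intros c Hc.
  - destruct (pigeonhole_infinite (fun k => c k []) K) as [v Hv]; [auto|].
    assert (Hm : forall m, exists kf : nat * (X -> X), m <= fst kf /\
            (forall x, T m x -> T (fst kf) (snd kf x) /\ res m (snd kf x) = x) /\
            c (fst kf) [] = v).
    { intros m. destruct (Hv m) as [k [Hk Hck]].
      assert (Hf : forall x, exists y, T m x -> T k y /\ res m y = x).
      { intros x. destruct (classic (T m x)) as [Hx|Hx]; [|exists x; contradiction].
        destruct (T_ext_ex m k x Hx Hk) as [y Hy]. exists y. auto. }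
      destruct (fun_choice _ _ _ Hf) as [f Hf']. exists (k, f). simpl. auto. }
    destruct (fun_choice _ _ _ Hm) as [kf Hkf].
    exists (fun m => fst (kf m), fun m => snd (kf m)), n, [], v.
    split; [intros m; destruct (Hkf m) as [H1 [H2 _]]; split; assumption|].
    split; [lia|]. split; [constructor|]. intros m ys _ Hys. inversion Hys. apply Hkf.
  - inversion HT as [|? ? Hz HT']; inversion HN as [|? ? Hnin HN']; subst.
    apply (add_root c K n z ts); auto.
Qed.

End HalpernLauchli.

(** * Trees of labelled sets and their morphisms *)

(* A node of level [n] is a perfect binary tree of depth [n], i.e. a labelling of the subsets of
   [{0, ..., n - 1}]: in [Nd t r] of level [n + 1] the row [r] labels the sets containing [n] and
   [t] those that do not. The restrictions of a node to smaller levels are its left subtrees. *)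
Inductive tr : Type := Lf (c : nat) | Nd (t r : tr).

Fixpoint lev (t : tr) : nat := match t with Lf _ => 0 | Nd t _ => S (lev t) end.

Fixpoint res (n : nat) (t : tr) : tr :=
  match t with
  | Lf c => Lf c
  | Nd t' r => if lev t' <? n then t else res n t'
  end.

Section Forest.

Variable al : nat -> nat.
Hypothesis al_pos : forall j, 0 < al j.

(* In a node of type [j] the label of a set of size [s] is less than [al (j + s)], so that rows
   of nodes of type [j] have type [j + 1]. *)
Fixpoint wt (j n : nat) (t : tr) : Prop :=
  match n, t with
  | 0, Lf c => c < al j
  | S n, Nd t r => wt j n t /\ wt (S j) n r
  | _, _ => False
  end.

Fixpoint nodes (j n : nat) : list tr :=
  match n with
  | 0 => map Lf (seq 0 (al j))
  | S n => map (fun p => Nd (fst p) (snd p)) (list_prod (nodes j n) (nodes (S j) n))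
  end.

Lemma in_nodes j n t : In t (nodes j n) <-> wt j n t.
Proof.
  revert j t. induction n as [|n IH]; intros j t; simpl; rewrite in_map_iff.
  - split.
    + intros [c [<- Hc]]. apply in_seq in Hc. lia.
    + destruct t as [c|]; [|contradiction]. intros Hc. exists c. split; [reflexivity|].
      apply in_seq. lia.
  - split.
    + intros [[a b] [<- Hab]]. apply in_prod_iff in Hab. simpl. now rewrite <- !IH.
    + destruct t as [|a b]; [contradiction|]. intros [Ha Hb]. exists (a, b).
      split; [reflexivity|]. apply in_prod; now apply IH.
Qed.

Lemma wt_lev j n t : wt j n t -> lev t = n.
Proof.
  revert j t. induction n as [|n IH]; intros j [c|t r]; simpl; try contradiction; auto.
  intros [H _]. f_equal. eauto.
Qed.

Lemma res_ge n t : lev t <= n -> res n t = t.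
Proof.
  destruct t as [c|t r]; simpl; [reflexivity|]. intros H.
  destruct (Nat.ltb_spec (lev t) n); [reflexivity|lia].
Qed.

Lemma res_Nd_le n t r : n <= lev t -> res n (Nd t r) = res n t.
Proof. intros H. simpl. destruct (Nat.ltb_spec (lev t) n); [lia|reflexivity]. Qed.

Lemma wt_res j m n t : wt j m t -> n <= m -> wt j n (res n t).
Proof.
  revert j t. induction m as [|m IH]; intros j t Ht Hn.
  - replace n with 0 by lia. destruct t; [exact Ht|contradiction].
  - destruct t as [|t r]; [contradiction|]. destruct (Nat.eq_dec n (S m)) as [->|Hne].
    + rewrite res_ge; [exact Ht|]. now rewrite (wt_lev _ _ _ Ht).
    + destruct Ht as [Ht Hr]. rewrite res_Nd_le by (rewrite (wt_lev _ _ _ Ht); lia).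
      apply IH; [exact Ht|lia].
Qed.

Lemma res_same j m t : wt j m t -> res m t = t.
Proof. intros H. apply res_ge. now rewrite (wt_lev _ _ _ H). Qed.

Lemma res_res m n t : m <= n -> res m (res n t) = res m t.
Proof.
  intros H. induction t as [c|t IH r _]; simpl; [reflexivity|].
  destruct (Nat.ltb_spec (lev t) n) as [H1|H1]; [reflexivity|].
  destruct (Nat.ltb_spec (lev t) m); [lia|exact IH].
Qed.

Fixpoint zn (n : nat) : tr := match n with 0 => Lf 0 | S n => Nd (zn n) (zn n) end.

Lemma wt_zn j n : wt j n (zn n).
Proof. revert j. induction n; intros j; simpl; auto. Qed.

Lemma wt_succ j n t : wt j n t -> wt j (S n) (Nd t (zn n)) /\ res n (Nd t (zn n)) = t.
Proof.
  intros H. split; [simpl; auto using wt_zn|].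
  rewrite res_Nd_le by (rewrite (wt_lev _ _ _ H); lia). eauto using res_same.
Qed.

Fixpoint pad (k : nat) (t : tr) : tr :=
  match k with 0 => t | S k => let t' := pad k t in Nd t' (zn (lev t')) end.

Lemma wt_pad j n k t : wt j n t -> wt j (k + n) (pad k t) /\ res n (pad k t) = t.
Proof.
  intros H. induction k as [|k [H1 H2]]; simpl.
  - split; [exact H|]. eauto using res_same.
  - rewrite (wt_lev _ _ _ H1). split; [auto using wt_zn|].
    destruct (Nat.ltb_spec (k + n) n); [lia|exact H2].
Qed.

(* Since [mf_step] is required of rows as well, a morphism preserves the label of every set of
   levels when the levels are mapped by [ml]. *)
Record mor : Type := Mor {
  ml : nat -> nat;
  mf : nat -> tr -> tr;
  ml_inc : forall n, ml n < ml (S n);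
  mf_wt : forall j n t, wt j n t -> wt j (ml n) (mf j t);
  mf_root : forall j t, wt j 0 t -> res 0 (mf j t) = t;
  mf_step : forall j n t r, wt j n t -> wt (S j) n r ->
    res (S (ml n)) (mf j (Nd t r)) = Nd (mf j t) (mf (S j) r) }.

Lemma ml_lt V i k : i < k -> ml V i < ml V k.
Proof. induction 1 as [|k Hk IH]; [apply ml_inc|]. pose proof (ml_inc V k). lia. Qed.

Lemma ml_le V i k : i <= k -> ml V i <= ml V k.
Proof.
  intros H. destruct (Nat.eq_dec i k) as [->|]; [lia|]. pose proof (ml_lt V i k). lia.
Qed.

Lemma ml_ge V i : i <= ml V i.
Proof. induction i as [|i IH]; [lia|]. pose proof (ml_inc V i). lia. Qed.

Lemma mf_res V j n m t : wt j n t -> m <= n -> res (ml V m) (mf V j t) = mf V j (res m t).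
Proof.
  intros Ht. induction 1 as [|n Hn IH] in t, Ht |- *.
  - rewrite (res_same _ _ _ Ht). eapply res_same, mf_wt, Ht.
  - destruct t as [|t r]; [contradiction|]. destruct Ht as [Ht Hr].
    rewrite res_Nd_le by (rewrite (wt_lev _ _ _ Ht); lia). rewrite <- IH by exact Ht.
    pose proof (ml_le V _ _ Hn). pose proof (mf_wt V _ _ _ Ht) as Hw.
    rewrite <- (res_res _ (S (ml V n))) by lia. rewrite (mf_step V j n) by auto.
    apply res_Nd_le. rewrite (wt_lev _ _ _ Hw). lia.
Qed.

Lemma mcomp_step V W j n t r : wt j n t -> wt (S j) n r ->
  res (S (ml V (ml W n))) (mf V j (mf W j (Nd t r))) =
  Nd (mf V j (mf W j t)) (mf V (S j) (mf W (S j) r)).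
Proof.
  intros Ht Hr. pose proof (ml_inc W n) as Hn.
  assert (Hw : wt j (ml W (S n)) (mf W j (Nd t r))) by (apply mf_wt; simpl; auto).
  pose proof (ml_inc V (ml W n)) as Hv.
  rewrite <- (res_res _ (ml V (S (ml W n)))) by lia.
  rewrite (mf_res V j _ _ _ Hw) by lia. rewrite (mf_step W j n) by auto.
  apply mf_step; apply mf_wt; auto.
Qed.

Definition mcomp (V W : mor) : mor.
Proof.
  refine (Mor (fun n => ml V (ml W n)) (fun j t => mf V j (mf W j t)) _ _ _ _).
  - intros n. apply ml_lt, ml_inc.
  - intros j n t H. apply mf_wt, mf_wt, H.
  - intros j t H. rewrite <- (mf_root W j t H) at 2.
    rewrite <- (mf_root V j (res 0 (mf W j t))).
    2:{ apply (wt_res _ (ml W 0)); [apply mf_wt, H|lia]. }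
    rewrite <- (mf_res V j (ml W 0) 0) by (try lia; apply mf_wt, H).
    rewrite res_res by lia. reflexivity.
  - intros j n t r. apply mcomp_step.
Defined.

Definition mid : mor.
Proof.
  refine (Mor (fun n => n) (fun _ t => t) _ _ _ _); auto.
  - intros j t H. eauto using res_same.
  - intros j n t r Ht Hr. apply (res_same j). simpl; auto.
Defined.

(** The part of the image of [t] that is forced by the images of its left subtree and of its row.
    For a node of level [n] it has level [plev l n], where [l] gives the levels of [f]. *)
Definition part (f : nat -> tr -> tr) (j : nat) (t : tr) : tr :=
  match t with Lf c => Lf c | Nd t r => Nd (f j t) (f (S j) r) end.

Definition plev (l : nat -> nat) (n : nat) : nat := match n with 0 => 0 | S n => S (l n) end.

Lemma res_part V j n t : wt j n t -> res (plev (ml V) n) (mf V j t) = part (mf V) j t.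
Proof.
  destruct n, t; simpl; try contradiction.
  - intros H. apply mf_root. exact H.
  - intros [H1 H2]. apply mf_step; auto.
Qed.

(* [pref j t y] is the desired image of [t], given that its restriction has to be [y]. *)
Lemma build (l : nat -> nat) (pref : nat -> tr -> tr -> tr) :
  (forall n, l n < l (S n)) ->
  exists W, (forall n, ml W n = l n) /\
    forall j n t, wt j n t -> let y := part (mf W) j t in
      wt j (l n) (pref j t y) -> res (plev l n) (pref j t y) = y -> mf W j t = pref j t y.
Proof.
  intros Hl.
  set (ok := fun j t y => wt j (l (lev t)) (pref j t y) /\
                          res (plev l (lev t)) (pref j t y) = y).
  (* An inadmissible preference is replaced by zero padding, so [pref] has to make sense only at the
     nodes of interest. *)
  set (ext := fun j t y => if excluded_middle_informative (ok j t y) then pref j t y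
                           else pad (l (lev t) - lev y) y).
  set (f := fix f (j : nat) (t : tr) {struct t} : tr :=
     ext j t (match t with Lf c => Lf c | Nd t r => Nd (f j t) (f (S j) r) end)).
  assert (Hf : forall j t, f j t = ext j t (part f j t)) by (intros j [c|t r]; reflexivity).
  assert (Hle : forall n, plev l n <= l n) by (intros [|n]; simpl; [lia|apply Hl]).
  assert (Hext : forall j n t y, wt j n t -> wt j (plev l n) y ->
            wt j (l n) (ext j t y) /\ res (plev l n) (ext j t y) = y).
  { intros j n t y Ht Hy. unfold ext. rewrite (wt_lev _ _ _ Ht).
    destruct (excluded_middle_informative _) as [Hok|_].
    - unfold ok in Hok. now rewrite (wt_lev _ _ _ Ht) in Hok.
    - rewrite (wt_lev _ _ _ Hy). pose proof (Hle n).
      replace (wt j (l n)) with (wt j ((l n - plev l n) + plev l n)) by (f_equal; lia).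
      now apply wt_pad. }
  assert (Hwt : forall n j t, wt j n t -> wt j (l n) (f j t) /\
            res (plev l n) (f j t) = part f j t).
  { induction n as [|n IH]; intros j t Ht; rewrite Hf; apply Hext; auto.
    - destruct t; simpl in *; [exact Ht|contradiction].
    - destruct t as [|t r]; [contradiction|]. destruct Ht as [Ht Hr]. simpl.
      split; now apply IH. }
  unshelve eexists (Mor l f Hl _ _ _).
  - intros j n t H. now apply Hwt.
  - intros j t H. destruct (Hwt 0 j t H) as [_ H0]. simpl in H0. rewrite H0.
    destruct t; [reflexivity|contradiction].
  - intros j n t r Ht Hr. apply (Hwt (S n)). simpl; auto.
  - simpl. split; [reflexivity|]. intros j n t Ht H1 H2. rewrite Hf. unfold ext.
    destruct (excluded_middle_informative _) as [|Hn]; [reflexivity|].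
    exfalso. apply Hn. unfold ok. rewrite (wt_lev _ _ _ Ht). auto.
Qed.

(** * Morphisms fixing an initial segment of levels, and agreement up to a level *)

Definition fixes (e : nat) (V : mor) : Prop := forall i, i < e -> ml V i = i.

Lemma fixes_comp e V W : fixes e V -> fixes e W -> fixes e (mcomp V W).
Proof. intros HV HW i Hi. simpl. now rewrite HW, HV. Qed.

Lemma fixes_le e e' V : e' <= e -> fixes e V -> fixes e' V.
Proof. intros He H i Hi. apply H. lia. Qed.

Lemma fixes_id e : fixes e mid.
Proof. intros i _. reflexivity. Qed.

(** With the levels below [e] in place, the forced part of the image of a node of level [e] is the
    node itself. *)
Lemma fixes_res e V j t : fixes e V -> wt j e t -> res e (mf V j t) = t.
Proof.
  intros HV. revert j t. induction e as [|e IH]; intros j t Ht.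
  - now apply mf_root.
  - destruct t as [|t r]; [contradiction|]. destruct Ht as [Ht Hr].
    assert (He : fixes e V) by (apply (fixes_le (S e)); auto).
    assert (E : forall j t, wt j e t -> mf V j t = t).
    { intros j' t' Ht'. rewrite <- (IH He j' t' Ht') at 2. symmetry. apply (res_same j').
      rewrite <- (HV e) at 1 by lia. now apply mf_wt. }
    rewrite <- (HV e) at 1 by lia. rewrite (mf_step V j e) by auto. now rewrite !E.
Qed.

Lemma fixes_mf e V j n t : fixes e V -> wt j n t -> n < e -> mf V j t = t.
Proof.
  intros HV Ht Hn. rewrite <- (fixes_res n V j t) at 2; auto.
  - symmetry. apply (res_same j). rewrite <- (HV n Hn) at 1. now apply mf_wt.
  - apply (fixes_le e); auto; lia.
Qed.

(** Agreement on finitely much data; the colourings to be treated are those that respect it. It also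
    replaces equality of composites, since morphisms carry proofs. *)
Definition eqv (d J : nat) (V W : mor) : Prop :=
  (forall i, i <= d -> ml V i = ml W i) /\
  forall j n t, j <= J -> n <= d -> wt j n t -> mf V j t = mf W j t.

Lemma eqv_refl d J V : eqv d J V V.
Proof. split; auto. Qed.

Lemma eqv_sym d J V W : eqv d J V W -> eqv d J W V.
Proof.
  intros [H1 H2]. split; [intros; symmetry; auto|]. intros. symmetry. eapply H2; eauto.
Qed.

Lemma eqv_trans d J U V W : eqv d J U V -> eqv d J V W -> eqv d J U W.
Proof.
  intros [H1 H2] [H3 H4]. split; [intros; rewrite H1; auto|].
  intros j n t Hj Hn Ht. rewrite (H2 j n) by auto. eapply H4; eauto.
Qed.

Lemma eqv_comp_r d J V W W' : eqv d J W W' -> eqv d J (mcomp V W) (mcomp V W').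
Proof.
  intros [H1 H2]. split; simpl.
  - intros i Hi. now rewrite H1.
  - intros j n t Hj Hn Ht. now rewrite (H2 j n).
Qed.

Lemma eqv_comp_l d J e V V' W : eqv e J V V' -> ml W d <= e ->
  eqv d J (mcomp V W) (mcomp V' W).
Proof.
  intros [H1 H2] He. split; simpl.
  - intros i Hi. apply H1. pose proof (ml_le W _ _ Hi). lia.
  - intros j n t Hj Hn Ht. apply (H2 j (ml W n)); auto.
    + pose proof (ml_le W _ _ Hn). lia.
    + now apply mf_wt.
Qed.

(** Placing the next level immediately after the previous one leaves no freedom: images at level
    [d + 1] consist of their forced part ([succ_top]). *)
Lemma succ_ex d V : exists V', (forall J, eqv d J V V') /\ ml V' (S d) = S (ml V d).
Proof.
  set (l := fun i => if i <=? d then ml V i else ml V d + (i - d)).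
  assert (Hl : forall n, l n < l (S n)).
  { intros n. unfold l. destruct (Nat.leb_spec n d), (Nat.leb_spec (S n) d); try lia.
    - apply ml_inc.
    - replace n with d by lia. lia. }
  destruct (build l (fun j t y => mf V j t) Hl) as [V' [H1 H2]].
  assert (H3 : forall n, n <= d -> forall j t, wt j n t -> mf V j t = mf V' j t).
  { induction n as [n IH] using lt_wf_ind. intros Hn j t Ht. symmetry. apply (H2 j n); auto.
    - unfold l. destruct (Nat.leb_spec n d); [now apply mf_wt|lia].
    - assert (E : part (mf V') j t = part (mf V) j t).
      { destruct n, t as [c|t r]; try contradiction; [reflexivity|]. destruct Ht as [Ht Hr].
        simpl. f_equal; symmetry; apply (IH n); auto; lia. }
      rewrite E. replace (plev l n) with (plev (ml V) n); [now apply res_part|].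
      destruct n; simpl; [reflexivity|]. unfold l. destruct (Nat.leb_spec n d); [reflexivity|lia]. }
  exists V'. split.
  - intros J. split.
    + intros i Hi. rewrite H1. unfold l. destruct (Nat.leb_spec i d); [reflexivity|lia].
    + intros j n t _ Hn Ht. eauto.
  - rewrite H1. unfold l. destruct (Nat.leb_spec (S d) d); lia.
Qed.

Lemma succ_top d V V' j t r : eqv d (S j) V V' -> ml V' (S d) = S (ml V d) ->
  wt j d t -> wt (S j) d r -> mf V' j (Nd t r) = Nd (mf V j t) (mf V (S j) r).
Proof.
  intros [H1 H2] Hs Ht Hr.
  assert (E : res (S (ml V' d)) (mf V' j (Nd t r)) = mf V' j (Nd t r)).
  { rewrite <- H1, <- Hs by lia. apply (res_same j). apply mf_wt. simpl; auto. }
  rewrite <- E, (mf_step V' j d) by auto. now rewrite <- (H2 j d), <- (H2 (S j) d) by auto.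
Qed.

Lemma mf_inj V n : forall j t t', wt j n t -> wt j n t' -> mf V j t = mf V j t' -> t = t'.
Proof.
  induction n as [|n IH]; intros j t t' Ht Ht' E.
  - rewrite <- (mf_root V j t), <- (mf_root V j t') by auto. now rewrite E.
  - destruct t as [|t r], t' as [|t' r']; try contradiction.
    destruct Ht as [Ht Hr], Ht' as [Ht' Hr'].
    pose proof (mf_step V j n t r Ht Hr) as E1. rewrite E, (mf_step V j n) in E1 by auto.
    injection E1 as E2 E3. f_equal; [apply (IH j)|apply (IH (S j))]; auto.
Qed.

(** Splits off the last step of [V]: [V'] keeps the levels up to [d], and [s] extends the forced
    part of each image at level [d + 1] to the whole image. This is well defined since [V'] is
    injective on the nodes of one type and level. *)
Lemma factor_through_succ d V V' : (forall J, eqv d J V V') -> ml V' (S d) = S (ml V d) ->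
  exists s, fixes (S (ml V d)) s /\ forall J, eqv (S d) J V (mcomp s V').
Proof.
  intros HV Hs. set (e := S (ml V d)).
  (* Levels below [e] stay, [e] goes where [V] puts [d + 1], and the later levels follow
     consecutively. *)
  set (l := fun i => if i <? e then i else ml V (S d) + (i - e)).
  assert (HVe : e <= ml V (S d)) by apply ml_inc.
  assert (Hl : forall n, l n < l (S n)).
  { intros n. unfold l. destruct (Nat.ltb_spec n e), (Nat.ltb_spec (S n) e); lia. }
  assert (Hpre : forall a : nat * tr, exists x, forall t, wt (fst a) (S d) t ->
            mf V' (fst a) t = snd a -> x = mf V (fst a) t).
  { intros [j y]. destruct (classic (exists t, wt j (S d) t /\ mf V' j t = y)) as [[t [Ht Et]]|Hn].
    - exists (mf V j t). simpl. intros t' Ht' Et'. f_equal.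
      apply (mf_inj V' (S d) j); auto. congruence.
    - exists y. simpl. intros t Ht Et. exfalso. eauto. }
  destruct (fun_choice _ _ _ Hpre) as [g Hg]. clear Hpre.
  destruct (build l (fun j t y => if lev t =? e then g (j, t) else y) Hl) as [s [H1 H2]].
  assert (Hfix : fixes e s).
  { intros i Hi. rewrite H1. unfold l. destruct (Nat.ltb_spec i e); lia. }
  assert (Hse : ml s e = ml V (S d)).
  { rewrite H1. unfold l. destruct (Nat.ltb_spec e e); lia. }
  assert (Hlow : forall J, eqv d J V (mcomp s V')).
  { intros J. destruct (HV J) as [H3 H4]. split; simpl.
    - intros i Hi. rewrite <- H3 by lia. symmetry. apply Hfix.
      pose proof (ml_le V _ _ Hi). unfold e. lia.
    - intros j n t Hj Hn Ht. rewrite <- (H4 j n) by auto. symmetry.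
      apply (fixes_mf e s j (ml V n)); [exact Hfix|now apply mf_wt|].
      pose proof (ml_le V _ _ Hn). unfold e. lia. }
  exists s. split; [exact Hfix|]. intros J. split.
  - intros i Hi. destruct (Nat.eq_dec i (S d)) as [->|].
    + simpl. rewrite Hs. symmetry. exact Hse.
    + apply (Hlow J). lia.
  - intros j n t Hj Hn Ht. destruct (Nat.eq_dec n (S d)) as [->|].
    2:{ apply (proj2 (Hlow J) j n); auto; lia. }
    assert (Hw : wt j e (mf V' j t)) by (unfold e; rewrite <- Hs; now apply mf_wt).
    destruct t as [|t r]; [contradiction|]. destruct Ht as [Ht Hr].
    assert (Etop : mf V' j (Nd t r) = Nd (mf V j t) (mf V (S j) r)).
    { apply (succ_top d); auto. }
    assert (Ey : part (mf s) j (mf V' j (Nd t r)) = mf V' j (Nd t r)).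
    { rewrite Etop. simpl. f_equal; apply (fixes_mf e s _ (ml V d)); auto; apply mf_wt; auto. }
    simpl. symmetry. rewrite (H2 j e _ Hw).
    + rewrite (wt_lev _ _ _ Hw), Nat.eqb_refl. symmetry. apply eq_sym, Hg; simpl; auto.
    + rewrite (wt_lev _ _ _ Hw), Nat.eqb_refl, (Hg _ (Nd t r)); simpl; auto.
      replace (l e) with (ml V (S d)) by (rewrite <- H1; auto). apply mf_wt. simpl; auto.
    + rewrite (wt_lev _ _ _ Hw), Nat.eqb_refl, (Hg _ (Nd t r)), Ey; simpl; auto.
      rewrite Etop. unfold e. simpl. unfold l.
      destruct (Nat.ltb_spec (ml V d) e); [|unfold e in *; lia].
      apply mf_step; auto.
Qed.

(** Level [n] no longer changes from [V (S n)] on, so the limit copies its behaviour there. *)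
Lemma limit (V : nat -> mor) :
  (forall i J, forall d, d < i -> eqv d J (V i) (V (S i))) ->
  exists W, forall i J d, d < i -> eqv d J W (V i).
Proof.
  intros HV.
  assert (HV' : forall i k J d, i <= k -> d < i -> eqv d J (V i) (V k)).
  { intros i k J d Hk Hd. induction Hk as [|k Hk IH]; [apply eqv_refl|].
    eapply eqv_trans; [exact IH|]. apply HV. lia. }
  set (l := fun n => ml (V (S n)) n).
  assert (Hl : forall n, l n < l (S n)).
  { intros n. unfold l. rewrite (proj1 (HV' (S n) (S (S n)) 0 n ltac:(lia) ltac:(lia)) n) by lia.
    apply ml_inc. }
  destruct (build l (fun j t y => mf (V (S (lev t))) j t) Hl) as [W [H1 H2]].
  assert (H3 : forall n j t, wt j n t -> mf W j t = mf (V (S n)) j t).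
  { induction n as [n IH] using lt_wf_ind. intros j t Ht.
    rewrite <- (wt_lev _ _ _ Ht). apply (H2 j n); auto; rewrite (wt_lev _ _ _ Ht).
    - unfold l. now apply mf_wt.
    - assert (E : part (mf W) j t = part (mf (V (S n))) j t).
      { destruct n, t as [c|t r]; try contradiction; [reflexivity|]. destruct Ht as [Ht Hr].
        simpl. f_equal.
        - rewrite (IH n) by auto.
          apply (proj2 (HV' (S n) (S (S n)) j n ltac:(lia) ltac:(lia)) j n); auto.
        - rewrite (IH n) by auto.
          apply (proj2 (HV' (S n) (S (S n)) (S j) n ltac:(lia) ltac:(lia)) (S j) n); auto. }
      rewrite E. replace (plev l n) with (plev (ml (V (S n))) n); [now apply res_part|].
      destruct n; simpl; [reflexivity|]. unfold l. f_equal. symmetry.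
      apply (HV' (S n) (S (S n)) 0 n); lia. }
  exists W. intros i J d Hd. split.
  - intros n Hn. rewrite H1. unfold l. apply (HV' (S n) i 0 n); lia.
  - intros j n t Hj Hn Ht. rewrite (H3 n) by auto.
    apply (proj2 (HV' (S n) i j n ltac:(lia) ltac:(lia)) j n); auto.
Qed.

End Forest.

(** * A Milliken-type theorem *)

Lemma Forall2_function (A B : Type) (R : A -> B -> Prop) xs ys (f0 : A -> B) :
  NoDup xs -> Forall2 R xs ys ->
  exists f, ys = map f xs /\ (forall x, In x xs -> R x (f x)) /\
    forall x, ~ In x xs -> f x = f0 x.
Proof.
  intros HN H. induction H as [|x y xs ys Hxy H IH].
  { exists f0. repeat split; auto. intros x []. }
  inversion HN as [|? ? Hx HN']; subst. destruct (IH HN') as [f [-> [H1 H2]]].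
  exists (fun a => if excluded_middle_informative (a = x) then y else f a).
  split; [|split].
  - simpl. destruct (excluded_middle_informative (x = x)); [|congruence]. f_equal.
    apply map_ext_in. intros a Ha. destruct (excluded_middle_informative (a = x)); congruence.
  - intros a [<-|Ha]; destruct (excluded_middle_informative _); subst; auto; congruence.
  - intros a Ha. destruct (excluded_middle_informative _) as [->|]; simpl in Ha; [tauto|].
    apply H2. tauto.
Qed.

Lemma Forall2_map_map (A B C : Type) (R : A -> B -> Prop) (f : C -> A) (g : C -> B) l :
  (forall x, In x l -> R (f x) (g x)) -> Forall2 R (map f l) (map g l).
Proof. intros H. induction l; simpl; constructor; auto using in_eq, in_cons. Qed.

Lemma representatives (A B : Type) (f : A -> B) (P : A -> Prop) (l : list B) :
  (forall a, P a -> In (f a) l) ->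
  exists l', (forall a, In a l' -> P a) /\ forall a, P a -> exists a', In a' l' /\ f a' = f a.
Proof.
  intros H.
  assert (Hl : exists l', (forall a, In a l' -> P a) /\
            forall a, P a -> In (f a) l -> exists a', In a' l' /\ f a' = f a).
  { clear H. induction l as [|b l [l' [H1 H2]]].
    { exists []. split; [intros a []|intros a _ []]. }
    destruct (classic (exists a, P a /\ f a = b)) as [[a [Ha Eb]]|Hn].
    - exists (a :: l'). split; [intros x [<-|Hx]; auto|].
      intros x Hx [->|Hin]; [exists a; simpl; auto|].
      destruct (H2 x Hx Hin) as [a' [Ha' E]]. exists a'. simpl. auto.
    - exists l'. split; [exact H1|]. intros x Hx [->|Hin]; [exfalso; apply Hn; eauto|auto]. }
  destruct Hl as [l' [H1 H2]]. exists l'. split; auto.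
Qed.

Lemma finite_lists (A : Type) (l : list A) n :
  exists L, forall xs, length xs = n -> Forall (fun x => In x l) xs -> In xs L.
Proof.
  destruct (finite_Forall2 nat A (fun _ a => In a l) (fun _ => ex_intro _ l (fun _ H => H))
              (repeat 0 n)) as [L HL].
  exists L. intros xs Hn Hxs. apply HL. subst n. clear HL. induction Hxs; simpl; constructor; auto.
Qed.

Lemma root_eq_dec (x y : nat * tr) : {x = y} + {x <> y}.
Proof. repeat decide equality. Defined.

Lemma finite_lists_le (A : Type) (l : list A) k :
  exists L, forall xs, length xs <= k -> Forall (fun x => In x l) xs -> In xs L.
Proof.
  induction k as [|k [L1 H1]].
  - exists [[]]. intros [|] Hk; [now left|simpl in Hk; lia].
  - destruct (finite_lists _ l (S k)) as [L2 H2]. exists (L2 ++ L1).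
    intros xs Hk HF. apply in_app_iff.
    destruct (Nat.eq_dec (length xs) (S k)); [left|right]; auto. apply H1; auto; lia.
Qed.

Section Ramsey.

Variable al : nat -> nat.
Hypothesis al_pos : forall j, 0 < al j.

Notation wt := (wt al).
Notation mor := (mor al).
Notation eqv := (eqv al).
Notation fixes := (fixes al).
Notation mcomp := (mcomp al).
Notation ml := (ml al).
Notation mf := (mf al).

Definition fT (n : nat) (x : nat * tr) : Prop := wt (fst x) n (snd x).
Definition fres (n : nat) (x : nat * tr) : nat * tr := (fst x, res n (snd x)).

(** A morphism moves nodes of all types at once, so all of these are roots in a single application
    of the Halpern-Läuchli theorem. *)
Definition roots (e J : nat) : list (nat * tr) :=
  nodup root_eq_dec
    (flat_map (fun j => map (pair j) (nodes al j e)) (seq 0 (S J))).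

Lemma in_roots e J j t : In (j, t) (roots e J) <-> j <= J /\ wt j e t.
Proof.
  unfold roots. rewrite nodup_In, in_flat_map. split.
  - intros [i [Hi Hin]]. apply in_seq in Hi. apply in_map_iff in Hin as [t' [E Ht]].
    injection E as -> ->. apply in_nodes in Ht. split; [lia|exact Ht].
  - intros [Hj Ht]. exists j. split; [apply in_seq; lia|]. apply in_map_iff. exists t.
    split; [reflexivity|]. now apply in_nodes.
Qed.

Lemma forest_halpern_lauchli (e J K : nat) (c : nat -> list (nat * tr) -> nat) :
  (forall k xs, c k xs < K) ->
  exists D n1 ss v, is_sel _ fT fres D /\ e <= n1 /\ above _ fT fres e n1 (roots e J) ss /\
    forall m ys, n1 <= m -> above _ fT fres n1 m ss ys -> c (fst D m) (map (snd D m) ys) = v.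
Proof.
  apply halpern_lauchli; unfold fT, fres.
  - intros m n [j t] Ht Hn. simpl in *. eauto using wt_res.
  - intros m [j t] Ht. simpl in *. f_equal. eauto using res_same.
  - intros m n n' [j t] Ht Hn _. simpl. f_equal. now apply res_res.
  - intros n [j t] Ht. exists (j, Nd t (zn n)). cbn [fst snd].
    destruct (wt_succ al al_pos j n t Ht) as [H1 H2]. rewrite H2. split; [exact H1|reflexivity].
  - intros n m [j t]. exists (map (pair j) (nodes al j m)). intros [j' t'] Ht E.
    injection E as -> _. apply in_map. now apply in_nodes.
  - apply Forall_forall. intros [j t] H. now apply in_roots in H.
  - apply NoDup_nodup.
Qed.

(** To [c], a morphism fixing [e] matters only through the level of [e] and the images of
    [roots e J], so [c] colours tuples of nodes of a common level. The Halpern-Läuchli selector is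
    woven into [E] so that every [mcomp E s] sends the roots to values of the selector. *)
Theorem pigeonhole (e J K : nat) (c : mor -> nat) :
  (forall V, c V < K) ->
  (forall V V', fixes e V -> fixes e V' -> eqv e J V V' -> c V = c V') ->
  exists E v, fixes e E /\ forall s, fixes e s -> c (mcomp E s) = v.
Proof.
  intros HK Hc.
  set (im := fun s : mor => map (fun x => (fst x, mf s (fst x) (snd x))) (roots e J)).
  assert (Hc' : forall a : nat * list (nat * tr), exists v, v < K /\
            forall s, fixes e s -> ml s e = fst a -> im s = snd a -> c s = v).
  { intros [k xs]. destruct (classic (exists s, fixes e s /\ ml s e = k /\ im s = xs))
      as [[s [H1 [H2 H3]]]|Hn].
    - exists (c s). split; [apply HK|]. simpl. intros s' H1' H2' H3'. apply Hc; auto.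
      split.
      + intros i Hi. destruct (Nat.eq_dec i e) as [->|]; [congruence|].
        rewrite H1, H1' by lia. reflexivity.
      + intros j n t Hj Hn Ht. destruct (Nat.eq_dec n e) as [->|].
        * assert (E : im s = im s') by congruence.
          pose proof (ext_in_map E (j, t) (proj2 (in_roots e J j t) (conj Hj Ht))) as E'.
          simpl in E'. congruence.
        * rewrite !(fixes_mf al e _ j n) by (auto; lia). reflexivity.
    - exists 0. split; [|intros s H1 H2 H3; exfalso; eauto].
      specialize (HK (mid al)). lia. }
  destruct (fun_choice _ _ _ Hc') as [c' Hc''].
  destruct (forest_halpern_lauchli e J K (fun k xs => c' (k, xs)))
    as [[k d] [n1 [ss [v [HD [Hn1 [Hss Hv]]]]]]].
  { intros k xs. apply Hc''. }
  assert (Hk : forall m, m <= k m) by (intros m; apply (HD m)).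
  assert (Hd : forall m j t, wt j m t ->
            exists t', d m (j, t) = (j, t') /\ wt j (k m) t' /\ res m t' = t).
  { intros m j t Ht. destruct (HD m) as [_ H]. destruct (H (j, t) Ht) as [H1 H2].
    simpl in *. destruct (d m (j, t)) as [j' t'] eqn:E. unfold fT, fres in *. simpl in *.
    injection H2 as -> <-. exists t'. auto. }
  (* Nodes of types beyond [J] are not among the roots but need images as well; for them [sg]
     pads. *)
  destruct (Forall2_function _ _ _ _ _ (fun x => (fst x, pad (n1 - e) (snd x)))
              (NoDup_nodup _ _) Hss)
    as [sg [Ess [Hsg1 Hsg2]]].
  fold (roots e J) in Ess, Hsg1, Hsg2.
  assert (Hsg : forall j t, wt j e t ->
            exists t', sg (j, t) = (j, t') /\ wt j n1 t' /\ res e t' = t).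
  { intros j t Ht. destruct (classic (In (j, t) (roots e J))) as [Hin|Hin].
    - destruct (Hsg1 _ Hin) as [H1 H2]. destruct (sg (j, t)) as [j' t'] eqn:E.
      unfold fT, fres in *. simpl in *. injection H2 as -> <-. exists t'. auto.
    - rewrite (Hsg2 _ Hin). simpl. destruct (wt_pad al al_pos j e (n1 - e) t Ht) as [H1 H2].
      exists (pad (n1 - e) t). replace (n1 - e + e) with n1 in H1 by lia. auto. }
  (* Level [e] goes to the selector level of [n1]. Each later level takes the forced part, one above
     the previous image, and applies the selector there. *)
  set (g := fix g (i : nat) : nat := match i with 0 => k n1 | S i => k (S (g i)) end).
  set (l := fun i => if i <? e then i else g (i - e)).
  assert (Hl : forall n, l n < l (S n)).
  { intros n. unfold l. destruct (Nat.ltb_spec n e), (Nat.ltb_spec (S n) e); try lia.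
    - replace (S n - e) with 0 by lia. simpl. specialize (Hk n1). lia.
    - replace (S n - e) with (S (n - e)) by lia. simpl. specialize (Hk (S (g (n - e)))). lia. }
  destruct (build al al_pos l (fun j t y => if lev t <? e then y else
             if lev t =? e then snd (d n1 (sg (j, y))) else snd (d (lev y) (j, y))) Hl)
    as [E [H1 H2]].
  assert (HE : fixes e E).
  { intros i Hi. rewrite H1. unfold l. destruct (Nat.ltb_spec i e); lia. }
  assert (Hbot : forall j t, wt j e t -> exists u u', sg (j, t) = (j, u) /\ d n1 (j, u) = (j, u') /\
            wt j n1 u /\ wt j (k n1) u' /\ res n1 u' = u /\ mf E j t = u').
  { intros j t Ht. destruct (Hsg j t Ht) as [u [Eu [Hu Ru]]].
    destruct (Hd n1 j u Hu) as [u' [Eu' [Hu' Ru']]].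
    exists u, u'. repeat split; auto.
    assert (Ey : part (mf E) j t = t).
    { destruct t as [c0|t r]; [reflexivity|]. destruct e as [|e']; [contradiction|].
      destruct Ht as [Ht Hr]. simpl. f_equal; apply (fixes_mf al (S e') E _ e'); auto. }
    rewrite (H2 j e t Ht);
      rewrite (wt_lev _ _ _ _ Ht), Nat.ltb_irrefl, Nat.eqb_refl, Ey, Eu, Eu'; simpl; auto.
    - unfold l. rewrite Nat.ltb_irrefl, Nat.sub_diag. exact Hu'.
    - replace (plev l e) with e.
      + rewrite <- (res_res e n1) by lia. now rewrite Ru'.
      + destruct e as [|e']; simpl; [reflexivity|]. unfold l.
        destruct (Nat.ltb_spec e' (S e')); lia. }
  assert (Htop : forall i j t r, wt j (i + e) t -> wt (S j) (i + e) r ->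
            exists u', d (S (g i)) (j, Nd (mf E j t) (mf E (S j) r)) = (j, u') /\
              wt j (k (S (g i))) u' /\ mf E j (Nd t r) = u' /\
              wt j (S (g i)) (Nd (mf E j t) (mf E (S j) r))).
  { intros i j t r Ht Hr.
    assert (Eg : ml E (i + e) = g i).
    { rewrite H1. unfold l. destruct (Nat.ltb_spec (i + e) e); [lia|]. f_equal. lia. }
    assert (Hy : wt j (S (g i)) (Nd (mf E j t) (mf E (S j) r))).
    { simpl. rewrite <- Eg. split; apply mf_wt; auto. }
    destruct (Hd _ j _ Hy) as [u' [Eu [Hu Ru]]]. exists u'. repeat split; auto; try apply Hy.
    assert (Hw : wt j (S (i + e)) (Nd t r)) by (simpl; auto).
    assert (E1 : lev (Nd t r) <? e = false).
    { rewrite (wt_lev _ _ _ _ Hw). apply Nat.ltb_ge. lia. }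
    assert (E2 : lev (Nd t r) =? e = false).
    { rewrite (wt_lev _ _ _ _ Hw). apply Nat.eqb_neq. lia. }
    assert (E3 : lev (part (mf E) j (Nd t r)) = S (g i)) by (apply (wt_lev _ _ _ _ Hy)).
    rewrite (H2 j (S (i + e)) _ Hw); rewrite E1, E2, E3; simpl part; rewrite Eu; simpl; auto.
    - unfold l. destruct (Nat.ltb_spec (S (i + e)) e); [lia|].
      replace (S (i + e) - e) with (S i) by lia. exact Hu.
    - rewrite <- H1, Eg. exact Ru. }
  assert (Hn1g : forall i, n1 <= g i).
  { induction i as [|i IH]; simpl; [apply Hk|]. specialize (Hk (S (g i))). lia. }
  (* All images stay in the cones chosen above the roots, where the colour is constant. *)
  assert (Hcone : forall i j t, wt j (i + e) t -> (j, res n1 (mf E j t)) = sg (j, res e t)).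
  { induction i as [|i IH]; intros j t Ht.
    - simpl in Ht. rewrite (res_same _ _ _ _ Ht).
      destruct (Hbot j t Ht) as [u [u' [-> [_ [_ [_ [<- ->]]]]]]]. reflexivity.
    - destruct t as [|t r]; [contradiction|]. destruct Ht as [Ht Hr].
      rewrite (res_Nd_le e) by (rewrite (wt_lev _ _ _ _ Ht); lia).
      rewrite <- (IH j t Ht). f_equal. symmetry.
      assert (Hw : wt j (S (i + e)) (Nd t r)) by (simpl; auto).
      assert (En : n1 <= ml E (i + e)).
      { rewrite H1. unfold l. destruct (Nat.ltb_spec (i + e) e); [lia|]. apply Hn1g. }
      rewrite <- (res_res n1 (ml E (i + e)) (mf E j (Nd t r))) by exact En.
      rewrite (mf_res al E j _ _ _ Hw) by lia.
      rewrite (res_Nd_le (i + e)) by (rewrite (wt_lev _ _ _ _ Ht); lia).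
      now rewrite (res_same _ _ _ _ Ht). }
  exists E, v. split; [exact HE|]. intros s Hs.
  assert (HEs : fixes e (mcomp E s)) by now apply fixes_comp.
  assert (Hlev : e <= ml s e) by apply ml_ge.
  (* If [s] leaves level [e] in place, [ys] is [ss] itself; otherwise it consists of the forced
     parts of the images. *)
  assert (Hys : exists m ys, n1 <= m /\ above _ fT fres n1 m ss ys /\
            ml (mcomp E s) e = k m /\ im (mcomp E s) = map (d m) ys).
  { remember (ml s e - e) as i eqn:Hi. assert (Ei : ml s e = i + e) by lia.
    destruct i as [|i].
    - exists n1, ss. split; [lia|]. split; [|split].
      + apply above_refl.
        { intros m [j t] Ht. unfold fres. simpl. f_equal. eapply res_same, Ht. }
        clear -Hss. induction Hss; constructor; tauto.
      + simpl. rewrite Ei, H1. unfold l. simpl. now rewrite Nat.ltb_irrefl, Nat.sub_diag.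
      + rewrite Ess, map_map. unfold im. apply map_ext_in. intros [j t] Hin.
        apply in_roots in Hin as [_ Ht]. simpl.
        assert (Est : mf s j t = t).
        { rewrite <- (fixes_res al e s j t) at 2 by auto. symmetry. apply (res_same al j).
          rewrite <- (plus_O_n e), <- Ei. now apply mf_wt. }
        rewrite Est. destruct (Hbot j t Ht) as [u [u' [-> [-> [_ [_ [_ ->]]]]]]]. reflexivity.
    - exists (S (g i)),
        (map (fun x => (fst x, part (mf E) (fst x) (mf s (fst x) (snd x)))) (roots e J)).
      assert (Hst : forall j t, wt j e t ->
                exists a b, mf s j t = Nd a b /\ wt j (i + e) a /\ wt (S j) (i + e) b).
      { intros j t Ht. pose proof (mf_wt al s _ _ _ Ht) as Hw. rewrite Ei in Hw.
        destruct (mf s j t) as [|a b]; [contradiction|]. exists a, b. simpl in Hw. tauto. }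
      split; [specialize (Hn1g i); lia|]. split; [|split].
      + rewrite Ess. apply Forall2_map_map. intros [j t] Hin.
        apply in_roots in Hin as [_ Ht]. destruct (Hst j t Ht) as [a [b [Est [Ha Hb]]]].
        simpl. rewrite Est. simpl. destruct (Htop i j a b Ha Hb) as [u' [_ [_ [_ Hy]]]].
        split; [exact Hy|]. unfold fres. simpl fst. simpl snd.
        rewrite res_Nd_le by (simpl in Hy; rewrite (wt_lev _ _ _ _ (proj1 Hy)); apply Hn1g).
        rewrite (Hcone i j a Ha). f_equal. f_equal.
        rewrite <- (fixes_res al e s j t Hs Ht), Est.
        rewrite res_Nd_le; [reflexivity|]. rewrite (wt_lev _ _ _ _ Ha). lia.
      + simpl. rewrite Ei, H1. unfold l. destruct (Nat.ltb_spec (S i + e) e); [lia|].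
        replace (S i + e - e) with (S i) by lia. reflexivity.
      + rewrite map_map. unfold im. apply map_ext_in. intros [j t] Hin.
        apply in_roots in Hin as [_ Ht]. simpl.
        destruct (Hst j t Ht) as [a [b [Est [Ha Hb]]]]. rewrite Est. simpl.
        destruct (Htop i j a b Ha Hb) as [u' [-> [_ [-> _]]]]. reflexivity. }
  destruct Hys as [m [ys [Hm [Hab [El Ei]]]]].
  rewrite <- (Hv m ys Hm Hab). simpl.
  apply (Hc'' (k m, map (d m) ys)); auto.
Qed.


Lemma finitely_many_types (d J k : nat) : exists l : list mor,
  (forall V, In V l -> ml V d = k) /\
  forall V, ml V d = k -> exists U, In U l /\ eqv d J U V.
Proof.
  set (N := flat_map (fun n => roots n J) (seq 0 (S d))).
  set (sg := fun V : mor => (map (ml V) (seq 0 (S d)), map (fun x => mf V (fst x) (snd x)) N)).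
  destruct (finite_lists _ (seq 0 (S k)) (S d)) as [L1 HL1].
  destruct (finite_lists _ (flat_map (fun j => flat_map (fun n => nodes al j n) (seq 0 (S k)))
              (seq 0 (S J))) (length N)) as [L2 HL2].
  destruct (representatives _ _ sg (fun V => ml V d = k) (list_prod L1 L2)) as [l [Hl1 Hl2]].
  { intros V HV.
    assert (Hle : forall i, i <= d -> ml V i <= k) by (intros i Hi; rewrite <- HV; now apply ml_le).
    apply in_prod.
    - apply HL1; [now rewrite length_map, length_seq|].
      apply Forall_map, Forall_forall. intros i Hi%in_seq. apply in_seq.
      specialize (Hle i). lia.
    - apply HL2; [now rewrite length_map|]. apply Forall_map, Forall_forall.
      intros [j t] Hin. apply in_flat_map in Hin as [n [Hn Hin]].
      apply in_seq in Hn. apply in_roots in Hin as [Hj Ht]. cbn [fst snd].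
      apply in_flat_map. exists j. split; [apply in_seq; lia|].
      apply in_flat_map. exists (ml V n). split.
      + apply in_seq. specialize (Hle n). lia.
      + apply in_nodes. now apply mf_wt. }
  exists l. split; [exact Hl1|]. intros V HV. destruct (Hl2 V HV) as [U [HU E]].
  exists U. split; [exact HU|].
  pose proof (f_equal fst E) as E1'. pose proof (f_equal snd E) as E2.
  cbn [sg fst snd] in E1', E2.
  split.
  - intros i Hi. apply (ext_in_map E1'). apply in_seq. lia.
  - intros j n t Hj Hn Ht. apply (ext_in_map E2 (j, t)). unfold N. apply in_flat_map.
    exists n. split; [apply in_seq; lia|]. apply in_roots. auto.
Qed.

(** The factors fix more and more levels, so the composites converge. Nothing is assumed about [P]
    at limits; hence the conclusion offers morphisms with [P] that agree with the limit as far as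
    desired. *)
Lemma fusion (P : nat -> mor -> Prop) :
  (forall n W, exists E, fixes n E /\ P n (mcomp W E)) ->
  (forall n W R, fixes n R -> P n W -> P n (mcomp W R)) ->
  exists W, forall n N J, exists V, P n V /\ eqv N J W V.
Proof.
  intros H1 H2.
  assert (H : forall a : nat * mor, exists E, fixes (fst a) E /\ P (fst a) (mcomp (snd a) E)).
  { intros [n W]. apply H1. }
  destruct (fun_choice _ _ _ H) as [e He].
  set (W := fix W (i : nat) : mor :=
         match i with 0 => mid al | S i => mcomp (W i) (e (i, W i)) end).
  destruct (limit al al_pos W) as [L HL].
  { intros i J d Hd. simpl. split.
    - intros k Hk. simpl. now rewrite (proj1 (He (i, W i))) by (simpl; lia).
    - intros j n t Hj Hn Ht. simpl.
      rewrite (fixes_mf al i (e (i, W i)) j n) by (auto; try apply (He (i, W i)); lia).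
      reflexivity. }
  assert (HP : forall n i, P n (W (S (i + n)))).
  { intros n. induction i as [|i IH]; [apply (He (n, W n))|].
    change (W (S (S i + n))) with (mcomp (W (S (i + n))) (e (S (i + n), W (S (i + n))))).
    apply H2; [|exact IH]. apply (fixes_le al (S (i + n))); [lia|].
    apply (He (S (i + n), W (S (i + n)))). }
  exists L. intros n N J. exists (W (S (N + n))). split; [apply HP|]. apply HL. lia.
Qed.

(* Fusion makes the colour independent of the last step of [V]; what remains depends on one level
   less but, because of the rows, on one type more. *)
Theorem ramsey (d : nat) : forall (J K : nat) (c : mor -> nat),
  (forall V, c V < K) -> (forall V V', eqv d J V V' -> c V = c V') ->
  exists W v, forall V, c (mcomp W V) = v.
Proof.
  induction d as [|d IH]; intros J K c HK Hc.
  { destruct (pigeonhole 0 J K c HK) as [E [v [_ Hv]]]; [intros; auto|].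
    exists E, v. intros V. apply Hv. intros i Hi. lia. }
  destruct (fun_choice _ _ _ (succ_ex al al_pos d)) as [sc Hsc].
  (* Rows of nodes of type [J] have type [J + 1]: here the additional type is used. *)
  assert (Hsc_eqv : forall V V', eqv d (S J) V V' -> eqv (S d) J (sc V) (sc V')).
  { intros V V' HV. destruct (Hsc V) as [H1 H2], (Hsc V') as [H3 H4].
    pose proof HV as [HV1 HV2]. split.
    - intros i Hi. destruct (Nat.eq_dec i (S d)) as [->|].
      + rewrite H2, H4, HV1; auto.
      + rewrite <- (proj1 (H1 0)), <- (proj1 (H3 0)) by lia. apply HV1. lia.
    - intros j n t Hj Hn Ht. destruct (Nat.eq_dec n (S d)) as [->|].
      + destruct t as [|t r]; [contradiction|]. destruct Ht as [Ht Hr].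
        rewrite (succ_top al d V), (succ_top al d V') by auto.
        rewrite (HV2 j d), (HV2 (S j) d) by (auto; lia). reflexivity.
      + rewrite <- (proj2 (H1 j) j n), <- (proj2 (H3 j) j n) by (auto; lia).
        apply (HV2 j n); auto; lia. }
  (* The colour ignores the last step [s] whenever [V] puts [d] at level [k]; [n = k + 1] is the
     first level that [s] may move. Nothing is demanded for [n = 0]. *)
  set (P := fun n W => forall k, n = S k -> forall V, ml V d = k ->
         forall s s', fixes n s -> fixes n s' ->
         c (mcomp W (mcomp s (sc V))) = c (mcomp W (mcomp s' (sc V)))).
  destruct (fusion P) as [W HW].
  - intros n W. destruct n as [|k].
    { exists (mid al). split; [apply fixes_id|]. intros k Hk. discriminate. }
    destruct (finitely_many_types d (S J) k) as [l [Hl1 Hl2]].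
    assert (Hl : exists E, fixes (S k) E /\ forall U, In U l -> forall s s',
              fixes (S k) s -> fixes (S k) s' ->
              c (mcomp W (mcomp E (mcomp s (sc U)))) = c (mcomp W (mcomp E (mcomp s' (sc U))))).
    { clear Hl2. induction l as [|U l IHl].
      { exists (mid al). split; [apply fixes_id|]. intros U []. }
      destruct IHl as [E [HE HEl]]; [intros; apply Hl1; now right|].
      destruct (pigeonhole (S k) J K (fun s => c (mcomp W (mcomp E (mcomp s (sc U))))))
        as [E' [v [HE' Hv]]].
      - intros s. apply HK.
      - intros s s' Hs Hs' Hss. apply Hc. apply eqv_comp_r, eqv_comp_r.
        apply (eqv_comp_l al (S d) J (S k)); [exact Hss|].
        rewrite (proj2 (Hsc U)), (Hl1 U); [lia|now left].
      - exists (mcomp E E'). split; [now apply fixes_comp|].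
        intros U' [<-|HU'] s s' Hs Hs'.
        (* Differently associated composites have the same maps but other proofs, so their colours
           are identified by [Hc]. *)
        + assert (Has : forall s, fixes (S k) s ->
                    c (mcomp W (mcomp (mcomp E E') (mcomp s (sc U)))) = v).
          { intros s0 Hs0. rewrite <- (Hv s0 Hs0). apply Hc. split; reflexivity. }
          now rewrite !Has.
        + assert (Has : forall s, c (mcomp W (mcomp (mcomp E E') (mcomp s (sc U')))) =
                    c (mcomp W (mcomp E (mcomp (mcomp E' s) (sc U'))))).
          { intros s0. apply Hc. split; reflexivity. }
          rewrite !Has. apply (HEl U' HU'); now apply fixes_comp. }
    destruct Hl as [E [HE HEl]]. exists E. split; [exact HE|].
    intros k' Hk' V HV s s' Hs Hs'. injection Hk' as <-.
    destruct (Hl2 V HV) as [U [HU HUV]]. apply Hsc_eqv in HUV.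
    assert (Hcc : forall s, c (mcomp (mcomp W E) (mcomp s (sc V))) =
                            c (mcomp W (mcomp E (mcomp s (sc U))))).
    { intros s0. transitivity (c (mcomp W (mcomp E (mcomp s0 (sc V))))).
      - apply Hc; split; reflexivity.
      - apply Hc. apply eqv_comp_r, eqv_comp_r, eqv_comp_r. now apply eqv_sym. }
    rewrite !Hcc. now apply HEl.
  - intros n W R HR HP k Hk V HV s s' Hs Hs'.
    assert (Has : forall s, c (mcomp (mcomp W R) (mcomp s (sc V))) =
              c (mcomp W (mcomp (mcomp R s) (sc V)))).
    { intros s0. apply Hc. split; reflexivity. }
    rewrite !Has. apply (HP k Hk V HV); now apply fixes_comp.
  - destruct (IH (S J) K (fun V => c (mcomp W V))) as [W' [v Hv]].
    + intros V. apply HK.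
    + intros V V' HV.
      set (k := ml V d).
      assert (Hk' : ml V' d = k) by (symmetry; apply HV; lia).
      (* The fused [W] is replaced by a morphism with property [P]; the sum bounds the levels of
         both images of [d + 1]. *)
      destruct (HW (S k) (ml V (S d) + ml V' (S d)) J) as [W0 [HP HE]].
      rewrite (Hc (mcomp W V) (mcomp W0 V)) by (apply (eqv_comp_l al _ _ _ _ _ _ HE); lia).
      rewrite (Hc (mcomp W V') (mcomp W0 V')) by (apply (eqv_comp_l al _ _ _ _ _ _ HE); lia).
      destruct (factor_through_succ al al_pos d V (sc V)) as [s [Hs Es]]; try apply Hsc.
      destruct (factor_through_succ al al_pos d V' (sc V')) as [s' [Hs' Es']]; try apply Hsc.
      fold k in Hs. rewrite Hk' in Hs'.
      rewrite (Hc (mcomp W0 V) (mcomp W0 (mcomp s (sc V)))) by (apply eqv_comp_r, Es).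
      rewrite (Hc (mcomp W0 V') (mcomp W0 (mcomp s' (sc V')))) by (apply eqv_comp_r, Es').
      rewrite (HP k eq_refl V eq_refl s s' Hs Hs').
      apply Hc. apply eqv_comp_r, eqv_comp_r. now apply Hsc_eqv.
    + exists (mcomp W W'), v. intros V. rewrite <- (Hv V). apply Hc. split; reflexivity.
Qed.

End Ramsey.

(** * Sparse nodes and envelopes *)

(** The labels of the sets with largest element [k], indexed by their remaining elements; the leaf
    case is a default. *)
Definition row (k : nat) (t : tr) : tr :=
  match res (S k) t with Nd _ r => r | Lf c => Lf c end.

Definition root (t : tr) : nat := match res 0 t with Lf c => c | Nd _ _ => 0 end.

(* The letter of [t] at the set of levels listed in decreasing order by [ks]. *)
Fixpoint val (t : tr) (ks : list nat) : nat :=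
  match ks with [] => root t | k :: ks => val (row k t) ks end.

Fixpoint dec (n : nat) (ks : list nat) : Prop :=
  match ks with [] => True | k :: ks => k < n /\ dec k ks end.

Lemma dec_le n n' ks : n <= n' -> dec n ks -> dec n' ks.
Proof. destruct ks; simpl; [auto|]. intros Hn [H1 H2]. split; [lia|exact H2]. Qed.

Lemma dec_app n I K : dec n (I ++ K) -> dec n I /\ dec n K.
Proof.
  revert n. induction I as [|i I IH]; simpl; intros n H; [auto|].
  destruct H as [H1 H2]. apply IH in H2 as [H2 H3]. split; [auto|].
  apply (dec_le i); auto; lia.
Qed.

Lemma dec_lt n ks : dec n ks -> Forall (fun k => k < n) ks.
Proof.
  revert n. induction ks as [|k ks IH]; simpl; intros n H; constructor; [tauto|].
  destruct H as [H1 H2]. apply IH in H2. eapply Forall_impl; [|exact H2]. simpl. lia.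
Qed.

Lemma dec_NoDup n ks : dec n ks -> NoDup ks.
Proof.
  revert n. induction ks as [|k ks IH]; simpl; intros n H; constructor.
  - destruct H as [_ H]. apply dec_lt in H. rewrite Forall_forall in H.
    intros Hin. specialize (H k Hin). lia.
  - apply (IH k). tauto.
Qed.

Lemma dec_map (f : nat -> nat) n ks : (forall i k, i < k -> f i < f k) -> dec n ks ->
  dec (f n) (map f ks).
Proof.
  intros Hf. revert n. induction ks as [|k ks IH]; simpl; intros n; [auto|].
  intros [H1 H2]. auto.
Qed.

Lemma Nd_res_row al j n k t : wt al j n t -> k < n -> res (S k) t = Nd (res k t) (row k t).
Proof.
  intros Ht Hk. unfold row. pose proof (wt_res al j n (S k) t Ht Hk) as Hw.
  destruct (res (S k) t) as [c|a b] eqn:E; [contradiction|]. destruct Hw as [Ha Hb]. f_equal.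
  rewrite <- (res_res k (S k)) by lia. rewrite E.
  rewrite res_Nd_le by (rewrite (wt_lev _ _ _ _ Ha); lia). symmetry. eapply res_same, Ha.
Qed.

Lemma wt_row al j n k t : wt al j n t -> k < n -> wt al (S j) k (row k t).
Proof.
  intros Ht Hk. pose proof (wt_res al j n (S k) t Ht Hk) as Hw.
  rewrite (Nd_res_row al j n) in Hw by auto. apply Hw.
Qed.

Lemma row_res k n t : k < n -> row k (res n t) = row k t.
Proof. intros H. unfold row. now rewrite res_res. Qed.

Lemma row_mf al (V : mor al) j n k t : wt al j n t -> k < n ->
  row (ml al V k) (mf al V j t) = mf al V (S j) (row k t).
Proof.
  intros Ht Hk. unfold row at 1. pose proof (ml_inc al V k).
  rewrite <- (res_res _ (ml al V (S k))) by lia.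
  rewrite (mf_res al V j n) by (auto; lia).
  rewrite (Nd_res_row al j n k t) by auto.
  rewrite (mf_step al V j k); [reflexivity| |].
  - apply (wt_res al j n); auto; lia.
  - now apply (wt_row al j n).
Qed.

Lemma root_mf al (V : mor al) j n t : wt al j n t -> root (mf al V j t) = root t.
Proof.
  intros Ht. unfold root. rewrite <- (res_res 0 (ml al V 0)) by lia.
  rewrite (mf_res al V j n) by (auto; lia). rewrite mf_root; [reflexivity|].
  apply (wt_res al j n); auto; lia.
Qed.

(** Rows go to rows and the label of the empty set is kept, so morphisms preserve all labels. This
    is why they act by embeddings. *)
Lemma val_mf al (V : mor al) ks : forall j n t, wt al j n t -> dec n ks ->
  val (mf al V j t) (map (ml al V) ks) = val t ks.
Proof.
  induction ks as [|k ks IH]; simpl; intros j n t Ht Hd.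
  - now apply (root_mf al V j n).
  - destruct Hd as [Hk Hd]. rewrite (row_mf al V j n) by auto.
    apply (IH (S j) k); [now apply (wt_row al j n)|exact Hd].
Qed.

Lemma root_res n t : root (res n t) = root t.
Proof. unfold root. rewrite res_res by lia. reflexivity. Qed.

(* Every family of nodes that is closed under restrictions and rows, and whose members only
   branch apart at the levels [l n], lies in the image of a morphism with levels [l]. *)
Lemma envelope al (l : nat -> nat) (N : nat) (F : nat -> nat -> tr -> Prop) :
  (forall j, 0 < al j) -> (forall n, l n < l (S n)) ->
  (forall j n y, n < N -> F j n y -> wt al j (l n) y) ->
  (forall j n y, S n < N -> F j (S n) y -> F j n (res (l n) y) /\ F (S j) n (row (l n) y)) ->
  (forall j y y', 0 < N -> F j 0 y -> F j 0 y' -> res 0 y = res 0 y' -> y = y') ->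
  (forall j n y y', S n < N -> F j (S n) y -> F j (S n) y' ->
     res (S (l n)) y = res (S (l n)) y' -> y = y') ->
  exists E : mor al, forall n j y, n < N -> F j n y -> exists t, wt al j n t /\ mf al E j t = y.
Proof.
  intros Hal Hl F1 F2 F3 F4.
  (* The function [g] recovers a member of [F] from its restriction to the forced level; the last
     two hypotheses make the member unique. *)
  assert (Hpre : forall a : nat * nat * tr, exists x, forall y,
            F (fst (fst a)) (snd (fst a)) y -> snd (fst a) < N ->
            res (plev l (snd (fst a))) y = snd a -> x = y).
  { intros [[j n] y0]. cbn [fst snd].
    destruct (classic (exists y, F j n y /\ n < N /\ res (plev l n) y = y0))
      as [[y [H1 [H2 H3]]]|Hn].
    - exists y. intros y' H1' _ H3'. destruct n as [|n].
      + apply (F3 j); auto. simpl in *. congruence.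
      + apply (F4 j n); auto. simpl in *. congruence.
    - exists y0. intros y H1 H2 H3. exfalso. apply Hn. eauto. }
  destruct (fun_choice _ _ _ Hpre) as [g Hg]. clear Hpre.
  destruct (build al Hal l (fun j t y => g (j, lev t, y)) Hl) as [E [H1 H2]].
  exists E. intros n. induction n as [|n IH]; intros j y Hn Hy.
  - pose proof (F1 j 0 y Hn Hy) as Hw.
    assert (Ht : wt al j 0 (res 0 y)) by (apply (wt_res al j (l 0)); auto; lia).
    exists (res 0 y). split; [exact Ht|].
    assert (Ep : part (mf al E) j (res 0 y) = res 0 y).
    { destruct (res 0 y); [reflexivity|contradiction]. }
    assert (Eg : g (j, lev (res 0 y), part (mf al E) j (res 0 y)) = y).
    { apply Hg; cbn [fst snd]; rewrite (wt_lev _ _ _ _ Ht); auto. }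
    etransitivity; [|exact Eg]. apply (H2 j 0); auto; rewrite Eg; auto.
  - destruct (F2 j n y Hn Hy) as [Ha Hb].
    destruct (IH j _ ltac:(lia) Ha) as [a [Wa Ea]].
    destruct (IH (S j) _ ltac:(lia) Hb) as [b [Wb Eb]].
    pose proof (F1 j (S n) y Hn Hy) as Hw.
    assert (Ht : wt al j (S n) (Nd a b)) by (simpl; auto).
    exists (Nd a b). split; [exact Ht|].
    assert (Ep : part (mf al E) j (Nd a b) = res (S (l n)) y).
    { simpl. rewrite Ea, Eb. symmetry. apply (Nd_res_row al j (l (S n))); auto. }
    assert (Eg : g (j, lev (Nd a b), part (mf al E) j (Nd a b)) = y).
    { apply Hg; cbn [fst snd]; rewrite (wt_lev _ _ _ _ Ht); auto. }
    etransitivity; [|exact Eg]. apply (H2 j (S n)); auto; rewrite Eg; auto.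
Qed.

(** Only the first [N] values enumerate [L]; beyond them [l] continues so that it can serve as the
    level function of a morphism. *)
Lemma enumerate_increasing (L : list nat) : exists (l : nat -> nat) (N : nat),
  (forall n, l n < l (S n)) /\ N <= length L /\ (forall n, n < N -> In (l n) L) /\
  forall x, In x L -> exists n, n < N /\ l n = x.
Proof.
  assert (H : forall B, exists (l : nat -> nat) (N : nat), (forall n, l n < l (S n)) /\
            (forall n, n < N -> In (l n) L /\ l n < B) /\
            forall x, In x L -> x < B -> exists n, n < N /\ l n = x).
  { induction B as [|B [l [N [H1 [H2 H3]]]]].
    { exists (fun n => n), 0. split; [auto|]. split; intros; lia. }
    destruct (in_dec Nat.eq_dec B L) as [HB|HB].
    - exists (fun n => if n <? N then l n else B + (n - N)), (S N). split; [|split].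
      + intros n. destruct (Nat.ltb_spec n N), (Nat.ltb_spec (S n) N); try lia; auto.
        specialize (H2 n). lia.
      + intros n Hn. destruct (Nat.ltb_spec n N) as [Hn'|Hn'].
        * destruct (H2 n Hn'). split; [assumption|lia].
        * replace (B + (n - N)) with B by lia. auto.
      + intros x Hx HxB. destruct (Nat.eq_dec x B) as [->|].
        * exists N. split; [lia|]. rewrite Nat.ltb_irrefl. lia.
        * destruct (H3 x Hx) as [i [Hi E]]; [lia|]. exists i. split; [lia|].
          destruct (Nat.ltb_spec i N); [exact E|lia].
    - exists l, N. split; [exact H1|]. split.
      + intros n Hn. destruct (H2 n Hn). split; [assumption|lia].
      + intros x Hx HxB. apply H3; [exact Hx|].
        destruct (Nat.eq_dec x B) as [->|]; [contradiction|lia]. }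
  destruct (H (S (list_sum L))) as [l [N [H1 [H2 H3]]]].
  assert (Hsum : forall x, In x L -> x <= list_sum L).
  { clear. induction L as [|a L IH]; simpl; [contradiction|]. intros x [->|Hx]; [lia|].
    specialize (IH x Hx). lia. }
  assert (Hlt : forall i k, i < k -> l i < l k).
  { intros i k. induction 1 as [|k Hk IH]; [apply H1|]. specialize (H1 k). lia. }
  exists l, N. split; [exact H1|]. split; [|split].
  - replace N with (length (map l (seq 0 N))) by now rewrite length_map, length_seq.
    apply NoDup_incl_length.
    + apply NoDup_map_NoDup_ForallPairs; [|apply seq_NoDup].
      intros i k _ _ E. destruct (lt_eq_lt_dec i k) as [[Hik|]|Hik]; auto;
        apply Hlt in Hik; lia.
    + intros x Hx. apply in_map_iff in Hx as [n [<- Hn]]. apply H2. apply in_seq in Hn. lia.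
  - intros n Hn. now apply H2.
  - intros x Hx. apply H3; [exact Hx|]. specialize (Hsum x Hx). lia.
Qed.

(** * Announcing relations with future vertices *)

Fixpoint enc (K : list nat) : nat :=
  match K with [] => 0 | x :: K => S (Cantor.to_nat (x, enc K)) end.

Lemma enc_inj K K' : enc K = enc K' -> K = K'.
Proof.
  revert K'. induction K as [|x K IH]; intros [|x' K']; cbn [enc]; try discriminate; auto.
  intros E. apply eq_add_S in E. apply Cantor.to_nat_inj in E. injection E as -> E. f_equal. auto.
Qed.

(* The level at which a node announces whether its relation with the vertices [K] has code [c]. *)
Definition query (K : list nat) (c : nat) : nat := S (2 * Cantor.to_nat (enc K, c)).

Lemma query_inj K c K' c' : query K c = query K' c' -> K = K' /\ c = c'.
Proof.
  unfold query. intros E.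
  assert (E' : Cantor.to_nat (enc K, c) = Cantor.to_nat (enc K', c')) by lia.
  apply Cantor.to_nat_inj in E'. injection E' as E1 E2. auto using enc_inj.
Qed.

Definition rfun : Type := list nat -> nat.

(** Only positive codes are asked for, so [zero] answers every query negatively. Queries are odd, so
    even levels announce nothing. *)
Definition bit (q : nat) (G : rfun) : nat :=
  if excluded_middle_informative (exists K c, q = query K c /\ 1 <= c /\ G K = c) then 1 else 0.

Lemma bit_le q G : bit q G <= 1.
Proof. unfold bit. destruct (excluded_middle_informative _); lia. Qed.

Lemma bit_query K c G : 1 <= c -> (bit (query K c) G = 1 <-> G K = c).
Proof.
  intros Hc. unfold bit. destruct (excluded_middle_informative _) as [H|H]; split; auto.
  - intros _. destruct H as [K' [c' [E [_ HG]]]]. apply query_inj in E as [-> ->]. exact HG.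
  - discriminate.
  - intros E. exfalso. apply H. exists K, c. auto.
Qed.

Lemma bit_even k G : bit (2 * k) G = 0.
Proof.
  unfold bit. destruct (excluded_middle_informative _) as [[K [c [E _]]]|]; [|reflexivity].
  unfold query in E. lia.
Qed.

Definition shift (G : rfun) (i : nat) : rfun := fun K => G (i :: K).
Definition zero : rfun := fun _ => 0.

Lemma bit_zero q : bit q zero = 0.
Proof.
  unfold bit. destruct (excluded_middle_informative _) as [[K [c [_ [Hc E]]]]|]; [|reflexivity].
  unfold zero in E. lia.
Qed.

Section Coding.

Variable al : nat -> nat.
Hypothesis al_two : forall j, 2 <= al j.

Definition admissible (j : nat) (G : rfun) : Prop := forall K, 2 * G K + 1 < al (j + length K).
Definition decreasing (K : list nat) : Prop := match K with [] => True | i :: K => dec i K end.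
Definition supported (G : rfun) : Prop := forall K, G K <> 0 -> decreasing K.

Lemma dec_decreasing n K : dec n K -> decreasing K.
Proof. destruct K; simpl; tauto. Qed.

Lemma admissible_shift j G i : admissible j G -> admissible (S j) (shift G i).
Proof.
  intros H K. specialize (H (i :: K)). cbn [length] in H.
  rewrite (Nat.add_succ_r j) in H. exact H.
Qed.

Lemma admissible_zero j : admissible j zero.
Proof. intros K. unfold zero. specialize (al_two (j + length K)). lia. Qed.

(* [p i] is the level of the vertex [i]; at the other levels only queries about the future
   relations of a node are answered, early enough to determine its row at the next vertex level. *)
Variables (p : nat -> nat) (vx : nat -> option nat) (M : nat).
Hypothesis p_inc : forall i, p i < p (S i).
Hypothesis p_even : forall i, exists k, p i = 2 * k.
Hypothesis vx_some : forall n i, vx n = Some i <-> n = p i.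
Hypothesis p_query : forall i j K c, j < M -> dec i K -> 2 * c + 1 < al (j + S (length K)) ->
  query (i :: K) c < p i.

Fixpoint Z (n b : nat) : tr :=
  match n with 0 => Lf b | S n => Nd (Z n b) (Z n 0) end.

(* [G K] is the relation code of a vertex together with the vertices [K] (and those already
   consumed by [shift]). Labels are even for relation codes and 1 for a positive answer. *)
Fixpoint Y (n : nat) (G : rfun) : tr :=
  match n with
  | 0 => Lf (2 * G [])
  | S n => Nd (Y n G) (match vx n with Some i => Y n (shift G i) | None => Z n (bit n G) end)
  end.

Lemma wt_Z j n b : b <= 1 -> wt al j n (Z n b).
Proof.
  revert j b. induction n as [|n IH]; intros j b Hb; simpl; [specialize (al_two j); lia|].
  split; apply IH; lia.
Qed.

Lemma wt_Y n : forall j G, admissible j G -> wt al j n (Y n G).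
Proof.
  induction n as [|n IH]; intros j G HG; simpl.
  - specialize (HG []). rewrite Nat.add_0_r in HG. simpl in *. lia.
  - split; [auto|]. destruct (vx n); [apply IH, admissible_shift, HG|apply wt_Z, bit_le].
Qed.

Lemma lev_Z n b : lev (Z n b) = n.
Proof. induction n in b |- *; simpl; auto. Qed.

Lemma lev_Y n G : lev (Y n G) = n.
Proof. induction n in G |- *; simpl; auto. Qed.

Lemma res_Z n m b : n <= m -> res n (Z m b) = Z n b.
Proof.
  induction 1 as [|m Hm IH]; [apply res_ge; now rewrite lev_Z|].
  simpl Z. rewrite res_Nd_le; [exact IH|]. now rewrite lev_Z.
Qed.

Lemma res_Y n m G : n <= m -> res n (Y m G) = Y n G.
Proof.
  induction 1 as [|m Hm IH]; [apply res_ge; now rewrite lev_Y|].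
  simpl Y. rewrite res_Nd_le; [exact IH|]. now rewrite lev_Y.
Qed.

Lemma row_Z n m b : n < m -> row n (Z m b) = Z n 0.
Proof. intros H. unfold row. now rewrite res_Z. Qed.

Lemma row_Y n m G : n < m ->
  row n (Y m G) = match vx n with Some i => Y n (shift G i) | None => Z n (bit n G) end.
Proof. intros H. unfold row. now rewrite res_Y. Qed.

Lemma root_Y n G : root (Y n G) = 2 * G [].
Proof. unfold root. rewrite res_Y by lia. reflexivity. Qed.

Lemma root_Z n b : root (Z n b) = b.
Proof. unfold root. rewrite res_Z by lia. reflexivity. Qed.

Lemma p_lt i k : i < k -> p i < p k.
Proof. induction 1 as [|k Hk IH]; [apply p_inc|]. specialize (p_inc k). lia. Qed.

Lemma val_Y K : forall n G, dec n (map p K) -> val (Y n G) (map p K) = 2 * G K.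
Proof.
  induction K as [|i K IH]; intros n G; [intros _; apply root_Y|].
  intros [H1 H2]. cbn [map val]. rewrite row_Y by exact H1.
  rewrite (proj2 (vx_some (p i) i) eq_refl). now rewrite IH.
Qed.

Lemma shift_zero i : shift zero i = zero.
Proof. reflexivity. Qed.

Lemma Y_zero n : Y n zero = Z n 0.
Proof.
  induction n as [|n IH]; [reflexivity|]. simpl. rewrite IH.
  destruct (vx n); [rewrite shift_zero, IH|rewrite bit_zero]; reflexivity.
Qed.

(** A nonzero code at [i :: K] shows as a positive bit below level [p i]. Equal bits carry it over
    to the other function, in both directions. *)
Lemma shift_determined j G G' i : j < M -> admissible j G -> admissible j G' ->
  supported G -> supported G' ->
  (forall q, q < p i -> bit q G = bit q G') -> shift G i = shift G' i.
Proof.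
  assert (H : forall G G', j < M -> admissible j G -> supported G ->
            (forall q, q < p i -> bit q G = bit q G') ->
            forall K, G (i :: K) <> 0 -> G' (i :: K) = G (i :: K)).
  { clear G G'. intros G G' Hj HG Hs Hb K HK.
    apply bit_query; [lia|]. rewrite <- Hb; [apply bit_query; [lia|reflexivity]|].
    apply (p_query i j); [exact Hj|exact (Hs _ HK)|exact (HG (i :: K))]. }
  intros Hj HG HG' Hs Hs' Hb. apply functional_extensionality. intros K. unfold shift.
  destruct (Nat.eq_dec (G (i :: K)) 0) as [E|E].
  - destruct (Nat.eq_dec (G' (i :: K)) 0) as [E'|E']; [congruence|].
    apply (H G' G); auto. intros q Hq. symmetry. auto.
  - symmetry. apply H; auto.
Qed.

(** Nodes with equal roots branch apart only at announcement levels: at the level of vertex [i] the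
    rows agree because they were announced before. *)
Lemma Y_determined j n G G' : j < M -> admissible j G -> admissible j G' ->
  supported G -> supported G' -> G [] = G' [] ->
  (forall q, q < n -> bit q G = bit q G') -> Y n G = Y n G'.
Proof.
  intros Hj HG HG' Hs Hs' E. induction n as [|n IH]; intros Hb; simpl; [now rewrite E|].
  rewrite IH by auto. f_equal.
  destruct (vx n) as [i|] eqn:Ev; [|rewrite (Hb n) by lia; reflexivity].
  apply vx_some in Ev. subst n. f_equal.
  apply (shift_determined j); auto.
Qed.

Section Envelope.

Variable base : nat -> rfun.
Hypothesis base_admissible : forall a, admissible 0 (base a).
Hypothesis base_supported : forall a K, base a K <> 0 -> dec a K.

Definition hat (a : nat) : tr := Y (p a) (base a).

Definition below (a : nat) (I : list nat) : rfun := fun K => base a (I ++ K).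

Lemma below_admissible a I : admissible (length I) (below a I).
Proof. intros K. unfold below. rewrite <- length_app. apply (base_admissible a). Qed.

Lemma below_supported a I : supported (below a I).
Proof.
  intros K HK. apply base_supported in HK. apply dec_app in HK as [_ HK].
  now apply dec_decreasing in HK.
Qed.

Lemma shift_below a I i : shift (below a I) i = below a (I ++ [i]).
Proof.
  apply functional_extensionality. intros K. unfold shift, below. now rewrite <- app_assoc.
Qed.

Lemma below_not_dec a I : ~ dec a I -> below a I = zero.
Proof.
  intros H. apply functional_extensionality. intros K. unfold zero, below.
  destruct (Nat.eq_dec (base a (I ++ K)) 0) as [E|E]; [exact E|].
  apply base_supported, dec_app in E. tauto.
Qed.

(** The nodes and their iterated rows at the chosen vertices come from finitely many functions,
    their number bounded independently of [y]. The levels of the chosen vertices and the first bit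
    differences of pairs of these functions form the level set of the envelope. *)
Lemma envelope_bounded : exists D, forall y : nat -> nat,
  exists E : mor al, forall x, x < M ->
    exists n u, n <= D /\ wt al 0 n u /\ mf al E 0 u = hat (y x).
Proof.
  destruct (finite_lists_le _ (seq 0 M) M) as [Is HIs].
  set (ix := list_prod (seq 0 M) Is).
  exists (M + (S (length ix)) * (S (length ix))). intros y.
  set (Gs := zero :: map (fun a => below (y (fst a)) (map y (snd a))) ix).
  (* The first level where the bits of two functions differ is never a vertex level, since bits at
     even levels are 0. The default 1 is odd, so it is not a vertex level either. *)
  assert (Hfd : forall a : rfun * rfun, exists q, (forall i, q <> p i) /\
            forall q', bit q' (fst a) <> bit q' (snd a) ->
            (forall q0, q0 < q' -> bit q0 (fst a) = bit q0 (snd a)) -> q' = q).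
  { intros [G G']. cbn [fst snd].
    destruct (classic (exists q', bit q' G <> bit q' G' /\
                forall q0, q0 < q' -> bit q0 G = bit q0 G')) as [[q [H1 H2]]|Hn].
    - exists q. split.
      { intros i ->. destruct (p_even i) as [k Ek]. rewrite Ek, !bit_even in H1. now apply H1. }
      intros q' H1' H2'. destruct (lt_eq_lt_dec q q') as [[Hq|]|Hq]; auto; exfalso; auto.
    - exists 1. split; [intros i; destruct (p_even i); lia|].
      intros q' H1 H2. exfalso. apply Hn. eauto. }
  destruct (fun_choice _ _ _ Hfd) as [fd Hfd']. clear Hfd.
  set (L := map (fun x => p (y x)) (seq 0 M) ++ map fd (list_prod Gs Gs)).
  destruct (enumerate_increasing L) as [l [N [Hl [HN [HlL HLl]]]]].
  assert (HND : N <= M + S (length ix) * S (length ix)).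
  { unfold L in HN. rewrite length_app, !length_map, length_prod, length_seq in HN.
    unfold Gs in HN. simpl length in HN. rewrite length_map in HN. exact HN. }
  set (GG := fun j G => G = zero \/ exists x I, x < M /\ Forall (fun x => x < M) I /\
               dec (y x) (map y I) /\ length I = j /\ G = below (y x) (map y I)).
  assert (Hlen : forall x I, x < M -> Forall (fun x => x < M) I -> dec (y x) (map y I) ->
            length I < M).
  { intros x I Hx HI Hd. rewrite <- (length_seq M 0).
    change (length (x :: I) <= length (seq 0 M)). apply NoDup_incl_length.
    - apply (NoDup_map_inv y). apply (dec_NoDup (S (y x))). simpl. auto.
    - intros z [<-|Hz]; apply in_seq; [split; lia|].
      rewrite Forall_forall in HI. specialize (HI z Hz). lia. }
  assert (HGs : forall j G, GG j G -> In G Gs).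
  { intros j G [->|[x [I [Hx [HI [Hd [Hj ->]]]]]]]; [now left|]. right.
    apply in_map_iff. exists (x, I). split; [reflexivity|]. apply in_prod; [apply in_seq; lia|].
    apply HIs; [specialize (Hlen x I Hx HI Hd); lia|]. eapply Forall_impl; [|exact HI].
    intros z Hz. cbv beta in Hz. apply in_seq. lia. }
  assert (HGadm : forall j G, GG j G -> admissible j G /\ supported G).
  { intros j G [->|[x [I [Hx [HI [Hd [<- ->]]]]]]].
    - split; [apply admissible_zero|]. intros K HK. now unfold zero in HK.
    - rewrite <- (length_map y I). split; [apply below_admissible|apply below_supported]. }
  assert (HGM : forall j G, GG j G -> j < M \/ G = zero).
  { intros j G [->|[x [I [Hx [HI [Hd [<- ->]]]]]]]; [auto|]. left. eauto. }
  (* The only vertex levels among the [l n] are the [p (y x')], so a shift appends some [y x'] to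
     the list, or gives [zero] when the order is violated. *)
  assert (HGsh : forall j G n i, GG j G -> n < N -> vx (l n) = Some i -> GG (S j) (shift G i)).
  { intros j G n i HG Hn Hi. destruct HG as [->|[x [I [Hx [HI [Hd [<- ->]]]]]]]; [now left|].
    apply vx_some in Hi. specialize (HlL n Hn). unfold L in HlL. apply in_app_iff in HlL.
    rewrite shift_below.
    destruct (classic (dec (y x) (map y I ++ [i]))) as [Hdi|Hdi];
      [|left; now apply below_not_dec].
    destruct HlL as [Hin|Hin].
    - apply in_map_iff in Hin as [x' [E Hx']]. apply in_seq in Hx'. rewrite Hi in E.
      assert (Ei : y x' = i).
      { destruct (lt_eq_lt_dec (y x') i) as [[H|]|H]; auto; apply p_lt in H; lia. }
      right. exists x, (I ++ [x']). rewrite map_app. simpl map. rewrite Ei. repeat split; auto.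
      + apply Forall_app. split; [exact HI|]. constructor; [lia|constructor].
      + rewrite length_app. simpl. lia.
    - exfalso. apply in_map_iff in Hin as [a [E _]]. apply (proj1 (Hfd' a) i). congruence. }
  (* A first difference of bits lies at a level given by [fd], hence in [L]. *)
  assert (Hsep : forall j j' G G' k, GG j G -> GG j' G' ->
            (forall n, n < N -> l n < k -> bit (l n) G = bit (l n) G') ->
            forall q, q < k -> bit q G = bit q G').
  { intros j j' G G' k HG HG' Hb. induction q as [q IHq] using lt_wf_ind. intros Hq.
    destruct (Nat.eq_dec (bit q G) (bit q G')) as [E|E]; [exact E|]. exfalso. apply E.
    assert (Eq : q = fd (G, G')).
    { apply (Hfd' (G, G')); [exact E|]. intros q0 Hq0. apply IHq; auto; lia. }
    destruct (HLl q) as [n [Hn En]]; [|rewrite <- En; apply Hb; auto; lia].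
    unfold L. apply in_app_iff. right. rewrite Eq. apply in_map. apply in_prod; eauto. }
  (* Rows at announcement levels are [Z _ 0], which is [Y _ zero], or [Z _ 1], which is therefore
     added to the family. *)
  set (F := fun j n t => (exists G, GG j G /\ t = Y (l n) G) \/ t = Z (l n) 1).
  assert (Hll : forall i k, i < k -> l i < l k).
  { intros i k. induction 1 as [|k Hk IH]; [apply Hl|]. specialize (Hl k). lia. }
  assert (HF0 : forall j n, F j n (Z (l n) 0)).
  { intros j n. left. exists zero. split; [now left|]. now rewrite Y_zero. }
  assert (HFeq : forall j n t t', F j n t -> F j n t' -> root t = root t' ->
            (forall i, i < N -> l i < l n -> row (l i) t = row (l i) t') -> t = t').
  { intros j n t t' [[G [HG ->]] | -> ] [[G' [HG' ->]] | -> ] Hr Hrow;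
      rewrite ?root_Y, ?root_Z in Hr; try lia; [|reflexivity].
    assert (Er : G [] = G' []) by lia.
    assert (Hb : forall q, q < l n -> bit q G = bit q G').
    { apply (Hsep j j); auto. intros i Hi Hin. specialize (Hrow i Hi Hin).
      rewrite !row_Y in Hrow by exact Hin. destruct (vx (l i)) as [a|] eqn:Ea.
      - apply vx_some in Ea. destruct (p_even a) as [k Ek]. now rewrite Ea, Ek, !bit_even.
      - apply (f_equal root) in Hrow. now rewrite !root_Z in Hrow. }
    destruct (HGadm j G HG) as [A1 S1], (HGadm j G' HG') as [A2 S2].
    destruct (HGM j G HG) as [HM|E1], (HGM j G' HG') as [HM'|E2];
      try (now apply (Y_determined j)). subst. reflexivity. }
  destruct (envelope al l N F) as [E HE].
  - intros j. specialize (al_two j). lia.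
  - exact Hl.
  - intros j n t _ [[G [HG ->]] | -> ]; [apply wt_Y, HGadm, HG|now apply wt_Z].
  - intros j n t Hn Ht. assert (Hn' : l n < l (S n)) by apply Hl.
    destruct Ht as [[G [HG ->]] | -> ].
    + rewrite res_Y by lia. rewrite row_Y by exact Hn'. split; [left; eauto|].
      destruct (vx (l n)) as [i|] eqn:Ei.
      * left. exists (shift G i). split; [|reflexivity]. apply (HGsh j G n); auto; lia.
      * pose proof (bit_le (l n) G). destruct (bit (l n) G) as [|[|b]]; [apply HF0|now right|lia].
    + rewrite res_Z by lia. rewrite row_Z by exact Hn'. split; [now right|apply HF0].
  - intros j t t' _ Ht Ht' Er. apply (HFeq j 0); auto.
    + now rewrite <- (root_res 0 t), Er, root_res.
    + intros i _ Hi. exfalso. destruct i as [|i]; [lia|]. specialize (Hll 0 (S i)). lia.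
  - intros j n t t' _ Ht Ht' Er. apply (HFeq j (S n)); auto.
    + now rewrite <- (root_res (S (l n)) t), Er, root_res.
    + intros i _ Hi. assert (Hin : l i < S (l n)).
      { destruct (le_lt_dec i n) as [Hi'|Hi'].
        - destruct (Nat.eq_dec i n) as [->|]; [lia|]. specialize (Hll i n). lia.
        - destruct (Nat.eq_dec i (S n)) as [->|]; [lia|]. specialize (Hll (S n) i). lia. }
      rewrite <- (row_res (l i) (S (l n)) t), <- (row_res (l i) (S (l n)) t') by exact Hin.
      now rewrite Er.
  - exists E. intros x Hx. destruct (HLl (p (y x))) as [n [Hn En]].
    { unfold L. apply in_app_iff. left. apply (in_map (fun x => p (y x))). apply in_seq. lia. }
    destruct (HE n 0 (hat (y x)) Hn) as [u [Hu Eu]].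
    { left. exists (base (y x)). split; [|unfold hat; now rewrite En]. right.
      exists x, []. repeat split; auto. }
    exists n, u. repeat split; auto. lia.
Qed.

End Envelope.
End Coding.

(** * Universal hypergraphs *)

(** Both lists begin with their common maximum. *)
Lemma dec_perm_unique K : forall n n' K', dec n K -> dec n' K' -> Permutation K K' -> K = K'.
Proof.
  induction K as [|x K IH]; intros n n' K' H H' HP.
  - now apply Permutation_nil in HP.
  - destruct K' as [|x' K']; [symmetry in HP; now apply Permutation_nil in HP|].
    destruct H as [_ H], H' as [_ H'].
    assert (E : x = x').
    { pose proof (dec_lt _ _ H) as F. pose proof (dec_lt _ _ H') as F'.
      rewrite Forall_forall in F, F'.
      assert (H1 : In x (x' :: K')) by (apply (Permutation_in x HP); now left).
      assert (H2 : In x' (x :: K)) by (apply (Permutation_in x' (Permutation_sym HP)); now left).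
      destruct H1 as [|H1]; [auto|]. destruct H2 as [|H2]; [auto|].
      specialize (F _ H2). specialize (F' _ H1). lia. }
    subst x'. f_equal. apply (IH x x); auto. now apply Permutation_cons_inv in HP.
Qed.

Lemma dec_insert x K : forall n, x < n -> dec n K -> ~ In x K ->
  exists K', dec n K' /\ Permutation (x :: K) K'.
Proof.
  induction K as [|y K IH]; intros n Hx Hd Hin.
  - exists [x]. simpl. auto.
  - destruct Hd as [Hy Hd]. destruct (lt_eq_lt_dec x y) as [[H|H]|H].
    + destruct (IH y H Hd) as [K' [H1 H2]]; [intros Hf; apply Hin; now right|].
      exists (y :: K'). split; [simpl; auto|]. rewrite perm_swap. now constructor.
    + subst. exfalso. apply Hin. now left.
    + exists (x :: y :: K). simpl. auto.
Qed.

Lemma dec_sort n t : NoDup t -> Forall (fun k => k < n) t ->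
  exists K, dec n K /\ Permutation t K.
Proof.
  induction 1 as [|x t Hx Ht IH]; intros HF; [exists []; simpl; auto|].
  inversion HF as [|? ? Hxn HF']; subst. destruct (IH HF') as [K [H1 H2]].
  destruct (dec_insert x K n Hxn H1) as [K' [H3 H4]].
  { intros Hin. apply Hx. apply (Permutation_in x (Permutation_sym H2) Hin). }
  exists K'. split; [exact H3|]. rewrite <- H4. now constructor.
Qed.

Lemma Forall_lt_list_sum t : Forall (fun k => k < S (list_sum t)) t.
Proof.
  induction t as [|x t IH]; simpl; constructor; [lia|]. eapply Forall_impl; [|exact IH].
  simpl. lia.
Qed.

(** Only finitely many queries have to precede the level of vertex [i], and [p i] is chosen
    recursively above them. The bound [lb] will make room for the unary colours. *)
Lemma vertex_levels (al lb : nat -> nat) (M : nat) :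
  exists (p : nat -> nat) (vx : nat -> option nat),
  (forall i, p i < p (S i)) /\ (forall i, exists k, p i = 2 * k) /\
  (forall n i, vx n = Some i <-> n = p i) /\ (forall i, lb i <= p i) /\
  (forall i j K c, j < M -> dec i K -> 2 * c + 1 < al (j + S (length K)) -> query (i :: K) c < p i).
Proof.
  assert (HB : forall i, exists b, forall j K c, j < M -> dec i K ->
            2 * c + 1 < al (j + S (length K)) -> query (i :: K) c < b).
  { intros i.
    destruct (finite_lists_le _ (seq 0 i) i) as [L HLi].
    set (qs := flat_map (fun K => flat_map (fun j => map (fun c => query (i :: K) c)
                 (seq 0 (al (j + S (length K))))) (seq 0 M)) L).
    exists (S (list_sum qs)). intros j K c Hj HK Hc.
    pose proof (Forall_lt_list_sum qs) as HF. rewrite Forall_forall in HF. apply HF.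
    unfold qs. apply in_flat_map. exists K. split.
    - apply HLi.
      + rewrite <- (length_seq i 0). apply NoDup_incl_length; [now apply (dec_NoDup i)|].
        intros x Hx. apply dec_lt in HK. rewrite Forall_forall in HK. apply in_seq.
        specialize (HK x Hx). lia.
      + apply dec_lt in HK. eapply Forall_impl; [|exact HK].
        intros x Hx. apply in_seq. cbv beta in Hx. lia.
    - apply in_flat_map. exists j. split; [apply in_seq; lia|].
      apply (in_map (fun c => query (i :: K) c)). apply in_seq. lia. }
  destruct (fun_choice _ _ _ HB) as [b Hb].
  set (p := fix p i :=
         match i with 0 => 2 * (lb 0 + b 0) | S i => 2 * (S (p i) + lb (S i) + b (S i)) end).
  assert (Hpb : forall i, lb i + b i <= p i) by (intros [|i]; simpl; lia).
  assert (Hpi : forall i, p i < p (S i)) by (intros i; simpl; lia).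
  assert (Hlt : forall i k, i < k -> p i < p k).
  { intros i k. induction 1 as [|k Hk IH]; [apply Hpi|]. specialize (Hpi k). lia. }
  assert (Hvx : forall n, exists o, forall i, o = Some i <-> n = p i).
  { intros n. destruct (classic (exists i, n = p i)) as [[i ->]|Hn].
    - exists (Some i). intros k. split; [intros E; injection E as ->; reflexivity|].
      intros E. f_equal. destruct (lt_eq_lt_dec i k) as [[Hk|]|Hk]; auto; apply Hlt in Hk; lia.
    - exists None. intros k. split; [discriminate|]. intros E. exfalso. eauto. }
  destruct (fun_choice _ _ _ Hvx) as [vx Hvx'].
  exists p, vx. split; [exact Hpi|]. split; [intros [|i]; eexists; cbn [p]; reflexivity|].
  split; [exact Hvx'|]. split; [intros i; specialize (Hpb i); lia|].
  intros i j K c Hj HK Hc. specialize (Hb i j K c Hj HK Hc). specialize (Hpb i). lia.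
Qed.

(** The finite levels are listed one after another: a position is the number of entries at earlier
    levels plus the index within the level. *)
Lemma level_enumeration (A : Type) (lv : A -> nat) (L : nat -> list A) :
  exists pos : A -> nat, forall v v', In v (L (lv v)) -> In v' (L (lv v')) ->
    (lv v < lv v' -> pos v < pos v') /\ (pos v = pos v' -> v = v').
Proof.
  assert (Hi : forall v, exists i, In v (L (lv v)) -> nth_error (L (lv v)) i = Some v).
  { intros v. destruct (classic (In v (L (lv v)))) as [Hv|Hv].
    - destruct (In_nth_error _ _ Hv) as [i Hi]. exists i. auto.
    - exists 0. contradiction. }
  destruct (fun_choice _ _ _ Hi) as [ix Hix].
  set (off := fix off n := match n with 0 => 0 | S n => off n + length (L n) end).
  assert (Hoff : forall n n', n < n' -> off n + length (L n) <= off n').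
  { intros n n'. induction 1 as [|n' Hn IH]; simpl; lia. }
  assert (Hlen : forall v, In v (L (lv v)) -> ix v < length (L (lv v))).
  { intros v Hv. apply nth_error_Some. rewrite (Hix v Hv). discriminate. }
  exists (fun v => off (lv v) + ix v). intros v v' Hv Hv'.
  pose proof (Hlen v Hv). pose proof (Hlen v' Hv'). split.
  - intros Hlt. specialize (Hoff _ _ Hlt). lia.
  - intros E. destruct (lt_eq_lt_dec (lv v) (lv v')) as [[Hlt|Heq]|Hlt].
    + specialize (Hoff _ _ Hlt). lia.
    + pose proof (Hix v Hv) as E1. pose proof (Hix v' Hv') as E2. rewrite Heq in E, E1.
      assert (Ei : ix v = ix v') by lia. rewrite Ei in E1. congruence.
    + specialize (Hoff _ _ Hlt). lia.
Qed.

(** Constancy on a right ideal survives shrinking the ideal, so finitely many colourings are treated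
    in turn. *)
Lemma ramsey_list (al : nat -> nat) (I : Type) (d J K : nat) (c : I -> mor al -> nat) (l : list I) :
  (forall j, 0 < al j) -> (forall i V, c i V < K) ->
  (forall i V V', eqv al d J V V' -> c i V = c i V') ->
  exists W, forall i, In i l -> exists v, forall V, c i (mcomp al W V) = v.
Proof.
  intros Hal HK Hc. induction l as [|i l [W HW]].
  - exists (mid al). intros i [].
  - destruct (ramsey al Hal d J K (fun V => c i (mcomp al W V))) as [W' [v Hv]].
    + intros V. apply HK.
    + intros V V' HV. apply Hc. now apply eqv_comp_r.
    + assert (Has : forall i V,
                c i (mcomp al (mcomp al W W') V) = c i (mcomp al W (mcomp al W' V))).
      { intros i' V. apply Hc. split; reflexivity. }
      exists (mcomp al W W'). intros i' [<-|Hi'].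
      * exists v. intros V. now rewrite Has.
      * destruct (HW i' Hi') as [v' Hv']. exists v'. intros V. now rewrite Has.
Qed.

(** * The hypergraph structure on the nodes *)

Section Hypergraphs.

Variable L : language.

(* A label carries a relation code (0 for none, [S k] for the symbol [k]) and a bit. *)
Definition alph (j : nat) : nat := 2 * (nsym L (S j) + 1).

Lemma alph_two j : 2 <= alph j.
Proof. unfold alph. lia. Qed.

(* A node of type 0 with a unary colour: 0 for none, [S k] for the symbol [k]. The colour is bounded
   by the level so that every level has finitely many vertices. *)
Definition vertex : Type := (tr * nat)%type.
Definition vlev (v : vertex) : nat := lev (fst v).
Definition is_vertex (v : vertex) : Prop := wt alph 0 (vlev v) (fst v) /\ snd v <= vlev v.

Section UniversalStructure.

Variable pos : vertex -> nat.
Hypothesis pos_lt : forall v v', is_vertex v -> is_vertex v' -> vlev v < vlev v' -> pos v < pos v'.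
Hypothesis pos_inj : forall v v', is_vertex v -> is_vertex v' -> pos v = pos v' -> v = v'.

(** The entries of a related tuple have distinct levels, and the one of greatest level carries the
    label. Odd labels give no relation, and numbers that are not positions of vertices lie in no
    relation. *)
Definition node_rel (a k : nat) (t : list nat) : Prop :=
  (a = 1 /\ valid_sym L 1 k /\ exists x, is_vertex (x, S k) /\ t = [pos (x, S k)]) \/
  (2 <= a /\ k < nsym L a /\ length t = a /\ exists v vs, Forall is_vertex (v :: vs) /\
     dec (vlev v) (map vlev vs) /\ Permutation t (map pos (v :: vs)) /\
     val (fst v) (map vlev vs) = 2 * S k).

Lemma node_rel_wf a k t : node_rel a k t ->
  valid_sym L a k /\ length t = a /\ Forall (inV None) t.
Proof.
  intros [[-> [Hv [x [_ ->]]]]|[Ha [Hk [Hl _]]]].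
  - repeat split; auto. constructor; simpl; auto.
  - split; [right; auto|]. split; [exact Hl|]. apply Forall_forall. simpl. auto.
Qed.

Definition node_structure : structure L := Structure L None node_rel node_rel_wf.

Lemma dec_pos v vs : Forall is_vertex (v :: vs) -> dec (vlev v) (map vlev vs) ->
  dec (S (pos v)) (map pos (v :: vs)).
Proof.
  intros HF Hd. simpl. split; [lia|]. revert v HF Hd.
  induction vs as [|w vs IH]; intros v HF Hd; simpl; [exact I|].
  inversion HF as [|? ? Hv HF']; subst. inversion HF' as [|? ? Hw _]; subst.
  destruct Hd as [Hd1 Hd2]. split; [now apply pos_lt|]. now apply IH.
Qed.

Lemma map_pos_inj vs vs' : Forall is_vertex vs -> Forall is_vertex vs' ->
  map pos vs = map pos vs' -> vs = vs'.
Proof.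
  intros H. revert vs'.
  induction H as [|v vs Hv H IH]; intros [|v' vs'] H'; simpl; try discriminate; auto.
  intros E. injection E as E1 E2. inversion H'; subst. f_equal; auto.
Qed.

(** Positions increase with levels, so both lists of positions are decreasing rearrangements of [t],
    of which there is only one. *)
Lemma vertices_unique t v vs v' vs' : Forall is_vertex (v :: vs) -> Forall is_vertex (v' :: vs') ->
  dec (vlev v) (map vlev vs) -> dec (vlev v') (map vlev vs') ->
  Permutation t (map pos (v :: vs)) -> Permutation t (map pos (v' :: vs')) -> v :: vs = v' :: vs'.
Proof.
  intros H1 H2 H3 H4 H5 H6. apply map_pos_inj; auto.
  apply (dec_perm_unique _ (S (pos v)) (S (pos v'))); try (now apply dec_pos).
  now rewrite <- H5.
Qed.

Lemma node_structure_hypergraph : hypergraph node_structure.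
Proof.
  split; [|split].
  - intros a k t [[_ [_ [x [_ ->]]]]|[_ [_ [_ [v [vs [H1 [H2 [H3 _]]]]]]]]].
    + constructor; [intros []|constructor].
    + apply (Permutation_NoDup (Permutation_sym H3)). apply (dec_NoDup (S (pos v))).
      now apply dec_pos.
  - intros a k t t' [[-> [Hv [x [Hx ->]]]]|[Ha [Hk [Hl [v [vs [H1 [H2 [H3 H4]]]]]]]]] HP.
    + apply Permutation_length_1_inv in HP as ->. left. eauto.
    + right. repeat split; auto.
      * now rewrite <- (Permutation_length HP).
      * exists v, vs. repeat split; auto. now rewrite <- HP.
  - intros a k a' k' t Ht Ht'.
    assert (Ea : a = a').
    { apply node_rel_wf in Ht as [_ [<- _]]. now apply node_rel_wf in Ht' as [_ [<- _]]. }
    split; [exact Ea|]. subst a'.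
    destruct Ht as [[-> [_ [x [Hx Et]]]]|[Ha [_ [_ [v [vs [H1 [H2 [H3 H4]]]]]]]]];
      destruct Ht' as [[E' [_ [x' [Hx' Et']]]]|[Ha' [_ [_ [v' [vs' [H1' [H2' [H3' H4']]]]]]]]];
      try lia.
    + rewrite Et in Et'. injection Et' as E. apply pos_inj in E; auto. congruence.
    + pose proof (vertices_unique t v vs v' vs' H1 H1' H2 H2' H3 H3') as E.
      injection E as -> ->. lia.
Qed.

End UniversalStructure.

Variable H : structure L.
Hypothesis H_hypergraph : hypergraph H.

Lemma unary_code (B : structure L) x :
  (forall k k', rel B 1 k [x] -> rel B 1 k' [x] -> k = k') ->
  exists v, forall k, v = S k <-> rel B 1 k [x].
Proof.
  intros HB. destruct (classic (exists k, rel B 1 k [x])) as [[k Hk]|Hn].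
  - exists (S k). intros k'. split; [intros E; injection E as <-; exact Hk|].
    intros Hk'. f_equal. auto.
  - exists 0. intros k. split; [discriminate|]. intros Hk. exfalso. eauto.
Qed.

(** A tuple lies in at most one relation, so one code suffices. The empty list is left out because
    unary relations are recorded by the colour of a vertex. *)
Lemma relation_code : exists base : nat -> rfun,
  (forall a, admissible alph 0 (base a)) /\ (forall a K, base a K <> 0 -> dec a K) /\
  forall a K k, dec a K -> K <> [] -> (base a K = S k <-> rel H (S (length K)) k (a :: K)).
Proof.
  assert (Hex : forall x : nat * list nat, exists v, v <= nsym L (S (length (snd x))) /\
            (v <> 0 -> dec (fst x) (snd x)) /\ (dec (fst x) (snd x) -> snd x <> [] ->
             forall k, v = S k <-> rel H (S (length (snd x))) k (fst x :: snd x))).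
  { intros [a K]. cbn [fst snd].
    destruct (classic (dec a K /\ K <> [] /\ exists k, rel H (S (length K)) k (a :: K)))
      as [[Hd [HK [k Hk]]]|Hn].
    - exists (S k). split; [|split; [auto|]].
      + destruct (rel_wf _ _ _ _ _ Hk) as [[[E _]|[_ Hlt]] _]; [|lia].
        destruct K; [contradiction|discriminate].
      + intros _ _ k'. split; [intros E; injection E as <-; exact Hk|].
        intros Hk'. f_equal. eapply H_hypergraph; eauto.
    - exists 0. split; [lia|]. split; [congruence|]. intros Hd HK k.
      split; [discriminate|]. intros Hk. exfalso. apply Hn. eauto. }
  destruct (fun_choice _ _ _ Hex) as [f Hf].
  exists (fun a K => f (a, K)). split; [|split].
  - intros a K. destruct (Hf (a, K)) as [H1 _]. simpl in H1. unfold alph. simpl. lia.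
  - intros a K. apply (Hf (a, K)).
  - intros a K k Hd HK. now apply (Hf (a, K)).
Qed.

End Hypergraphs.

(** * Finite big Ramsey degrees *)

Lemma strictly_increasing_ge (f : nat -> nat) :
  (forall i k, i < k -> f i < f k) -> forall n, n <= f n.
Proof. intros H n. induction n as [|n IH]; [lia|]. specialize (H n (S n)). lia. Qed.

Theorem theorem5p1 (L : language) (H : structure L) :
  universal_hypergraph H -> finite_big_ramsey_degrees H.
Proof.
  intros [HH HU] A m HA [g0 Hg0].
  assert (Hal : forall j, 0 < alph L j) by (intros j; pose proof (alph_two L j); lia).
  destruct (level_enumeration (vertex) vlev
    (fun n => list_prod (nodes (alph L) 0 n) (seq 0 (S n)))) as [pos Hpos].
  assert (Hin : forall v, is_vertex L v ->
            In v (list_prod (nodes (alph L) 0 (vlev v)) (seq 0 (S (vlev v))))).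
  { intros [t c] [H1 H2]. apply in_prod; [now apply in_nodes|]. apply in_seq. simpl in *. lia. }
  assert (pos_lt : forall v v', is_vertex L v -> is_vertex L v' -> vlev v < vlev v' ->
            pos v < pos v').
  { intros v v' Hv Hv'. apply Hpos; auto. }
  assert (pos_inj : forall v v', is_vertex L v -> is_vertex L v' -> pos v = pos v' -> v = v').
  { intros v v' Hv Hv'. apply Hpos; auto. }
  clear Hpos Hin.
  (* The node structure embeds into [H] by universality; the self-embedding [f] of [H] will pass
     through this copy. *)
  destruct (HU _ (node_structure_hypergraph L pos pos_lt pos_inj)) as [g [Hg1 [Hg2 Hg3]]].
  assert (Hg2' : forall i k, i < k -> g i < g k) by (intros i k; apply Hg2; exact I).
  assert (HN : vset H = None).
  { destruct (vset H) as [n|] eqn:E; [|reflexivity]. exfalso.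
    specialize (Hg1 n I). simpl in Hg1. pose proof (strictly_increasing_ge g Hg2' n). lia. }
  destruct (fun_choice _ _ _ (fun x => unary_code L H x (fun k k' H1 H2 =>
    proj2 (proj2 (proj2 HH) _ _ _ _ _ H1 H2)))) as [uc Huc].
  assert (HuA : forall x, exists v, forall k, v = S k <-> rel A 1 k [x]).
  { intros x. apply unary_code. intros k k' H1 H2.
    destruct (rel_wf _ _ _ _ _ H1) as [V1 [_ F1]]. destruct (rel_wf _ _ _ _ _ H2) as [V2 _].
    apply Hg0 in H1; auto. apply Hg0 in H2; auto. eapply HH; eauto. }
  destruct (fun_choice _ _ _ HuA) as [uA HuA']. clear HuA.
  destruct (relation_code L H HH) as [base [Hb1 [Hb2 Hb3]]].
  (* Taking [uc] as lower bound makes the unary colour of each vertex admissible at its level. *)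
  destruct (vertex_levels (alph L) uc m) as [p [vx [Hp1 [Hp2 [Hp3 [Hp4 Hp5]]]]]].
  assert (Hplt : forall i k, i < k -> p i < p k) by (apply p_lt; exact Hp1).
  destruct (envelope_bounded (alph L) (alph_two L) p vx m Hp1 Hp2 Hp3 Hp5 base Hb1 Hb2) as [D HD].
  set (x_ := hat p vx base) in *.
  set (nds := flat_map (fun n => nodes (alph L) 0 n) (seq 0 (S D))).
  destruct (finite_lists _ nds m) as [Us HUs].
  (* The list [Us] contains every choice of [m] nodes of level at most [D]; each entry will
     contribute one colour. *)
  exists (length Us). intros K chi Hchi.
  set (img := fun (us : list tr) (V : mor (alph L)) =>
    map (fun x => g (pos (mf _ V 0 (nth x us (Lf 0)), uA x))) (seq 0 m)).
  set (ok := fun us : list tr => length us = m /\ Forall (fun u => In u nds) us).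
  (* Under [ok], the colour depends only on the images of nodes of type 0 and level at most [D];
     otherwise it is the default 0. *)
  set (c := fun us V => if excluded_middle_informative (ok us) then chi (img us V) else 0).
  destruct (ramsey_list (alph L) _ D 0 K c Us Hal) as [W HW].
  { intros us V. unfold c. destruct (excluded_middle_informative _); [apply Hchi|].
    specialize (Hchi []). lia. }
  { intros us V V' HV. unfold c.
    destruct (excluded_middle_informative _) as [[Hl Hok]|]; [|reflexivity].
    f_equal. unfold img. apply map_ext_in. intros x Hx. do 3 f_equal.
    rewrite Forall_forall in Hok. apply in_seq in Hx.
    assert (Hn : In (nth x us (Lf 0)) nds) by (apply Hok, nth_In; lia).
    unfold nds in Hn. apply in_flat_map in Hn as [n [Hn Hn']]. apply in_nodes in Hn'.
    apply in_seq in Hn. apply (proj2 HV 0 n); auto; lia. }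
  (* Vertex [j] of [H] goes to the image under [W] of its sparse node and keeps its unary colour. *)
  set (vt := fun j => ((mf _ W 0 (x_ j), uc j) : vertex)).
  assert (Hwt : forall j, wt (alph L) 0 (p j) (x_ j)).
  { intros j. apply wt_Y; [apply alph_two|apply Hb1]. }
  assert (Hvl : forall j, vlev (vt j) = ml _ W (p j)).
  { intros j. unfold vlev, vt. simpl. eapply wt_lev, mf_wt, Hwt. }
  assert (Hvt : forall j, is_vertex L (vt j)).
  { intros j. unfold is_vertex. rewrite Hvl. split; [apply mf_wt, Hwt|]. simpl.
    pose proof (ml_ge _ W (p j)). specialize (Hp4 j). lia. }
  assert (HvF : forall js, Forall (is_vertex L) (map vt js)).
  { intros js. apply Forall_map, Forall_forall. auto. }
  assert (Hlev : forall i k, i < k -> vlev (vt i) < vlev (vt k)).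
  { intros i k Hik. rewrite !Hvl. apply ml_lt. auto. }
  assert (Hmono : forall i k, i < k -> pos (vt i) < pos (vt k)).
  { intros i k Hik. apply pos_lt; auto. }
  assert (Hdecl : forall j Ks, dec j Ks -> dec (vlev (vt j)) (map vlev (map vt Ks))).
  { intros j Ks Hd. rewrite map_map. now apply (dec_map (fun i => vlev (vt i))). }
  assert (Hval : forall j Ks, dec j Ks -> val (fst (vt j)) (map vlev (map vt Ks)) = 2 * base j Ks).
  { intros j Ks Hd. rewrite map_map, (map_ext _ (fun i => ml _ W (p i)) Hvl), <- map_map.
    assert (Hd' : dec (p j) (map p Ks)) by now apply dec_map.
    simpl. rewrite (val_mf _ W _ 0 (p j)) by auto. now apply val_Y. }
  set (f := fun j => g (pos (vt j))).
  assert (Hf : embedding H H f).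
  { split; [|split].
    - intros x _. rewrite HN. exact I.
    - intros x y _ _ Hxy. apply Hg2'. auto.
    - intros a k t Hv Hl _.
      assert (Eft : map f t = map g (map (fun j => pos (vt j)) t)) by now rewrite map_map.
      rewrite Eft, <- (Hg3 a k) by (try rewrite length_map; auto; apply Forall_forall; simpl; auto).
      (* Unary relations are read off the colours. For higher arities the tuple is sorted
         decreasingly, and its label is twice the relation code. *)
      simpl. destruct Hv as [[-> Hv]|[Ha Hk]].
      + destruct t as [|j [|]]; try discriminate. simpl. rewrite <- Huc. split.
        * intros E. left. split; [reflexivity|]. split; [left; auto|].
          exists (mf _ W 0 (x_ j)). rewrite <- E. split; [apply Hvt|reflexivity].
        * intros [[_ [_ [x [Hx E]]]]|[Ha _]]; [|lia]. injection E as E.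
          apply pos_inj in E; auto. unfold vt in E. congruence.
      + split.
        * intros Ht. right. repeat split; auto; [now rewrite length_map|].
          destruct (dec_sort (S (list_sum t)) t) as [[|j Ks] [Hd HP]];
            [eapply HH; eauto|apply Forall_lt_list_sum| |].
          { apply Permutation_length in HP. simpl in HP. lia. }
          destruct Hd as [_ Hd]. exists (vt j), (map vt Ks). split; [|split; [auto|split]].
          -- apply (HvF (j :: Ks)).
          -- rewrite HP. simpl. now rewrite map_map.
          -- rewrite Hval by exact Hd. f_equal. apply Hb3; auto.
             ++ intros ->. apply Permutation_length in HP. simpl in HP. lia.
             ++ replace (S (length Ks)) with a.
                ** eapply HH; eauto.
                ** apply Permutation_length in HP. simpl in HP. lia.
        * intros [[-> _]|[_ [_ [_ [v [vs [H1 [H2 [H3 H4]]]]]]]]]; [lia|].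
          assert (Hnd : NoDup t).
          { apply (NoDup_map_inv (fun j => pos (vt j))).
            apply (Permutation_NoDup (Permutation_sym H3)).
            apply (dec_NoDup (S (pos v))). now apply (dec_pos L). }
          destruct (dec_sort (S (list_sum t)) t) as [[|j Ks] [Hd HP]];
            [exact Hnd|apply Forall_lt_list_sum| |].
          { apply Permutation_length in HP. simpl in HP. lia. }
          destruct Hd as [_ Hd].
          assert (E : vt j :: map vt Ks = v :: vs).
          { apply (vertices_unique L pos pos_lt pos_inj (map (fun j => pos (vt j)) t)); auto.
            rewrite HP. simpl. now rewrite map_map. }
          injection E as <- <-. rewrite Hval in H4 by exact Hd.
          assert (Er : base j Ks = S k) by lia. apply Hb3 in Er; auto.
          -- replace (S (length Ks)) with a in Er.
             ++ eapply HH; [exact Er|]. now symmetry.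
             ++ apply Permutation_length in HP. simpl in HP. lia.
          -- intros ->. apply Permutation_length in HP. simpl in HP. lia. }
  assert (Hv : forall us, exists v, In us Us -> forall V, c us (mcomp _ W V) = v).
  { intros us. destruct (classic (In us Us)) as [Hus|Hus]; [|exists 0; contradiction].
    destruct (HW us Hus) as [v Hv]. exists v. auto. }
  destruct (fun_choice _ _ _ Hv) as [cl Hcl].
  exists f. split; [exact Hf|]. exists (map cl Us). split; [now rewrite length_map|].
  intros e He Himg.
  assert (Hy : forall x, exists y, x < m -> e x = f y).
  { intros x. destruct (le_lt_dec m x) as [|Hx]; [exists 0; lia|].
    destruct (Himg x Hx) as [y [_ Hy]]. exists y. auto. }
  destruct (fun_choice _ _ _ Hy) as [y Hy']. clear Hy.
  (* Both [e] and [f] preserve unary relations, so all copies of [A] have the colours [uA] used in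
     [img]. *)
  assert (Huy : forall x, x < m -> uc (y x) = uA x).
  { intros x Hx.
    assert (Hk : forall k, uc (y x) = S k <-> uA x = S k).
    { intros k. rewrite Huc, HuA'.
      assert (HFA : Forall (inV (vset A)) [x]) by (rewrite HA; constructor; auto).
      assert (HFH : Forall (inV (vset H)) [y x]) by (rewrite HN; constructor; simpl; auto).
      split; intros Hr; destruct (rel_wf _ _ _ _ _ Hr) as [Hvs _].
      - apply (proj2 (proj2 He)); auto. simpl. rewrite (Hy' x Hx).
        apply (proj2 (proj2 Hf) 1 k [y x]); auto.
      - apply (proj2 (proj2 He)) in Hr; auto. simpl in Hr. rewrite (Hy' x Hx) in Hr.
        apply (proj2 (proj2 Hf) 1 k [y x]); auto. }
    destruct (uc (y x)) as [|k]; [|symmetry; now apply Hk].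
    destruct (uA x) as [|k]; [reflexivity|]. now apply Hk. }
  (* One morphism [E] reaches the sparse nodes of the copy from nodes [us] of level at most [D]. The
     copy is then [img us] of the composite of [W] and [E], whose colour depends on [us] alone. *)
  destruct (HD y) as [E HE].
  assert (Hu : forall x, exists u, x < m -> In u nds /\ mf _ E 0 u = x_ (y x)).
  { intros x. destruct (le_lt_dec m x) as [|Hx]; [exists (Lf 0); lia|].
    destruct (HE x Hx) as [n [u [Hn [Hwu Hu]]]]. exists u. intros _. split; [|exact Hu].
    apply in_flat_map. exists n. split; [apply in_seq; lia|]. now apply in_nodes. }
  destruct (fun_choice _ _ _ Hu) as [u Hu'].
  set (us := map u (seq 0 m)).
  assert (Hok : ok us).
  { split; [unfold us; now rewrite length_map, length_seq|]. apply Forall_forall.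
    intros z Hz. apply in_map_iff in Hz as [x [<- Hx]]. apply in_seq in Hx. apply Hu'. lia. }
  assert (Hus : In us Us) by (apply HUs; apply Hok).
  apply in_map_iff. exists us. split; [|exact Hus].
  rewrite <- (Hcl us Hus E). unfold c.
  destruct (excluded_middle_informative (ok us)) as [_|]; [|contradiction].
  f_equal. unfold img, code. apply map_ext_in. intros x Hx. apply in_seq in Hx.
  rewrite (Hy' x) by lia. unfold f, vt. rewrite Huy by lia. do 3 f_equal. simpl. f_equal.
  unfold us. rewrite (nth_indep _ (Lf 0) (u 0)) by (rewrite length_map, length_seq; lia).
  rewrite map_nth, seq_nth by lia. apply Hu'. lia.
Qed.
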